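(* Let $k$ be an algebraically closed field of characteristic zero, and let $X\subset\mathbb{P}^4_{x_1,\dots,x_5}$ be a cubic threefold over $k$ given either by $$x_3x_4^2+(x_1x_2+x_3^2)x_5+e_1x_4^2x_5+e_2x_4x_5^2+e_3x_5^3=0,\qquad e_1,e_2,e_3\in k,$$ or by $$x_5(x_1x_2+x_3^2)+x_4^3+e_1x_4x_5^2+e_2x_5^3=0,\qquad e_1,e_2\in k.$$ Let $n\geq 2$ be even, let $\zeta_n\in k$ be a primitive $n$-th root of unity, and let $G=\mathfrak{D}_n\subset\mathrm{Aut}(X)$ be the dihedral group (of order $2n$) generated by $$\tau_{\zeta_n}=\mathrm{diag}(\zeta_n,\zeta_n^{-1},1,1,1)\quad\text{and}\quad \sigma_{(12)}:(x_1,x_2,x_3,x_4,x_5)\mapsto(x_2,x_1,x_3,x_4,x_5).$$ Assume that $G$ does not fix any singular point of $X$. Then the $G$-action on $X$ is not linearizable. In particular, the $\mathrm{Aut}(X)$-action on $X$ is not linearizable.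
   Context: A $G$-action on $\mathbb{P}^n$ is called linear if it arises from the projectivization $\mathbb{P}(V)$ of a $G$-representation $V$. A $G$-action on an $n$-dimensional projective variety $X$ is linearizable if $X$ is $G$-equivariantly birational to $\mathbb{P}^n$ with a linear $G$-action; the same terminology is used for the action of $\mathrm{Aut}(X)$. *)

(* Defs.v *)
From mathcomp Require Import all_boot all_order all_algebra.
From mathcomp Require Import mpoly.

Set Implicit Arguments.
Unset Strict Implicit.
Unset Printing Implicit Defensive.

Import GRing.Theory.
Local Open Scope ring_scope.

(* P^n over k: the lines of k^(n+1). *)
Definition proj (k : fieldType) (n : nat) : Type :=
  {L : {vspace 'cV[k]_n.+1} | \dim L == 1%N}.

(* A choice of homogeneous coordinates of p.  It is only used with homogeneous
   polynomials and in conditions invariant under rescaling. *)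
Definition hcoord (k : fieldType) (n : nat) (p : proj k n) : 'I_n.+1 -> k :=
  fun i => vpick (val p) i 0.

(* The default p is not used when A is invertible: see val_pact. *)
Definition pact (k : fieldType) (n : nat) (A : 'M[k]_n.+1) (p : proj k n) :
    proj k n :=
  insubd p (linfun (mulmx A) @: val p)%VS.

Lemma val_pact (k : fieldType) (n : nat) (A : 'M[k]_n.+1) (p : proj k n) :
  A \in unitmx -> val (pact A p) = (linfun (mulmx A) @: val p)%VS.
Proof.
move=> uA; rewrite /pact insubdK //= unfold_in limg_dim_eq ?(eqP (valP p)) //.
suff -> : lker (linfun (mulmx A) : 'End('cV[k]_n.+1)) = 0%VS by rewrite capv0.
by apply/eqP/lker0P => u v; rewrite !lfunE /= => /(can_inj (mulKmx uA)).
Qed.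

(* A projective variety in P^m is given by its set of points Z; its regular
   self-maps are functions on the subtype below. *)
Definition points (k : fieldType) (m : nat) (Z : pred (proj k m)) : Type :=
  {p : proj k m | Z p}.

(* The tuple f sends p to q = [f_0(p) : ... : f_n(p)].  In particular the f_i do
   not all vanish at p, since the line q is nonzero. *)
Definition maps_to (k : fieldType) (m n : nat)
    (f : 'I_n.+1 -> {mpoly k[m.+1]}) (p : proj k m) (q : proj k n) : Prop :=
  val q = <[\col_i (f i).@[hcoord p]]>%VS.

Definition homog_tuple (k : fieldType) (m n : nat)
    (f : 'I_n.+1 -> {mpoly k[m.+1]}) : Prop :=
  exists d : nat, forall i, f i \is d.-homog.

Definition regular (k : fieldType) (m : nat) (Z : pred (proj k m))
    (phi : points Z -> points Z) : Prop :=
  forall p : points Z,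
  exists (f : 'I_m.+1 -> {mpoly k[m.+1]}) (d : nat) (h : {mpoly k[m.+1]}),
    [/\ homog_tuple f, h \is d.-homog, h.@[hcoord (val p)] != 0
      & forall q : points Z, h.@[hcoord (val q)] != 0 ->
          maps_to f (val q) (val (phi q))].

Definition Aut (k : fieldType) (m : nat) (Z : pred (proj k m))
    (phi : points Z -> points Z) : Prop :=
  regular phi /\
  exists psi, [/\ regular psi, cancel phi psi & cancel psi phi].

Inductive generated (T : Type) (S : (T -> T) -> Prop) : (T -> T) -> Prop :=
| gen_base phi : S phi -> generated S phi
| gen_id : generated S id
| gen_comp phi psi :
    generated S phi -> generated S psi -> generated S (phi \o psi)
| gen_inv phi psi :
    generated S phi -> cancel phi psi -> cancel psi phi -> generated S psi.

(* For irreducible Z and W, such an f represents a rational map from Z to W. *)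
Definition rational_map (k : fieldType) (m n : nat)
    (Z : pred (proj k m)) (W : pred (proj k n))
    (f : 'I_n.+1 -> {mpoly k[m.+1]}) : Prop :=
  [/\ homog_tuple f,
      exists p q, Z p /\ maps_to f p q
    & forall p q, Z p -> maps_to f p q -> W q].

(* The composite of f and g is defined and equal to the identity of Z, as a
   rational map. *)
Definition rational_cancel (k : fieldType) (m n : nat) (Z : pred (proj k m))
    (f : 'I_n.+1 -> {mpoly k[m.+1]}) (g : 'I_m.+1 -> {mpoly k[n.+1]}) : Prop :=
  (exists p q r, [/\ Z p, maps_to f p q & maps_to g q r]) /\
  (forall p q r, Z p -> maps_to f p q -> maps_to g q r -> r = p).

Definition birational_map (k : fieldType) (m n : nat)
    (Z : pred (proj k m)) (W : pred (proj k n))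
    (f : 'I_n.+1 -> {mpoly k[m.+1]}) : Prop :=
  rational_map Z W f /\
  exists g, [/\ rational_map W Z g, rational_cancel Z f g
              & rational_cancel W g f].

Definition representation (k : fieldType) (T : Type) (n : nat)
    (G : (T -> T) -> Prop) (rho : (T -> T) -> 'M[k]_n) : Prop :=
  (forall phi, G phi -> rho phi \in unitmx) /\
  (forall phi psi, G phi -> G psi -> rho (phi \o psi) = rho phi *m rho psi).

(* For irreducible Z, two rational maps agree as soon as they agree wherever the
   chosen tuples are both defined; this is how equivariance is expressed. *)
Definition equivariant (k : fieldType) (m n : nat) (Z : pred (proj k m))
    (G : (points Z -> points Z) -> Prop)
    (rho : (points Z -> points Z) -> 'M[k]_n.+1)
    (f : 'I_n.+1 -> {mpoly k[m.+1]}) : Prop :=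
  forall phi, G phi -> forall (p : points Z) (q r : proj k n),
    maps_to f (val p) q -> maps_to f (val (phi p)) r -> r = pact (rho phi) q.

Definition linearizable (k : fieldType) (m n : nat) (Z : pred (proj k m))
    (G : (points Z -> points Z) -> Prop) : Prop :=
  exists rho : (points Z -> points Z) -> 'M[k]_n.+1,
    representation G rho /\
    exists f, birational_map Z predT f /\ equivariant G rho f.

Definition hypersurface (k : fieldType) (m : nat) (F : {mpoly k[m.+1]}) :
    pred (proj k m) :=
  fun p => F.@[hcoord p] == 0.

(* Jacobian criterion; F is assumed to generate the ideal of the hypersurface. *)
Definition singular (k : fieldType) (m : nat) (F : {mpoly k[m.+1]})
    (p : points (hypersurface F)) : Prop :=
  forall i, (F^`M(i)).@[hcoord (val p)] = 0.

(* The restriction to Z of the projective transformation given by A; the default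
   p is not used when A preserves Z: see val_restr. *)
Definition restr (k : fieldType) (m : nat) (Z : pred (proj k m))
    (A : 'M[k]_m.+1) (p : points Z) : points Z :=
  insubd p (pact A (val p)).

Lemma val_restr (k : fieldType) (m : nat) (Z : pred (proj k m))
    (A : 'M[k]_m.+1) (p : points Z) :
  (forall q, Z q -> Z (pact A q)) -> val (restr A p) = pact A (val p).
Proof. by move=> ZA; rewrite /restr insubdK //; apply/ZA/(valP p). Qed.

(* The coordinate x_j, numbered from 1. *)
Definition coordx (k : fieldType) (j : nat) : {mpoly k[5]} := 'X_(inord j.-1).

Definition cubic1 (k : fieldType) (e1 e2 e3 : k) : {mpoly k[5]} :=
  let x1 := coordx k 1 in let x2 := coordx k 2 in let x3 := coordx k 3 in
  let x4 := coordx k 4 in let x5 := coordx k 5 in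
  x3 * x4 ^+ 2 + (x1 * x2 + x3 ^+ 2) * x5
  + e1 *: (x4 ^+ 2 * x5) + e2 *: (x4 * x5 ^+ 2) + e3 *: (x5 ^+ 3).

Definition cubic2 (k : fieldType) (e1 e2 : k) : {mpoly k[5]} :=
  let x1 := coordx k 1 in let x2 := coordx k 2 in let x3 := coordx k 3 in
  let x4 := coordx k 4 in let x5 := coordx k 5 in
  x5 * (x1 * x2 + x3 ^+ 2) + x4 ^+ 3
  + e1 *: (x4 * x5 ^+ 2) + e2 *: (x5 ^+ 3).

Definition tau_mx (k : fieldType) (zeta : k) : 'M[k]_5 :=
  diag_mx (\row_i nth 1 [:: zeta; zeta^-1] i).

Definition sigma_mx (k : fieldType) : 'M[k]_5 :=
  tperm_mx (inord 0) (inord 1).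

Definition dihedral (k : fieldType) (Z : pred (proj k 4)) (zeta : k) :
    (points Z -> points Z) -> Prop :=
  generated (fun phi => phi = restr (tau_mx zeta)
                        \/ phi = restr (sigma_mx k)).

(* Main.v *)
Require Import Defs.
From HB Require Import structures.
From mathcomp Require Import all_boot all_order all_algebra all_field.
From mathcomp Require Import mpoly perm ring zify.
From Stdlib Require Import Classical FunctionalExtensionality.

Set Implicit Arguments.
Unset Strict Implicit.
Unset Printing Implicit Defensive.

Import Order.TTheory GRing.Theory.
Local Open Scope ring_scope.

(** Completing the square in [x3] puts the equations of both families, on
    the chart [x5 = 1], into the form [x1 x2 + s^2 = D(t)] with [t = x4] and
    [D] of degree 4 or 3.  A multiple root of [D] gives a singular point on
    [x1 = x2 = 0], and [G] fixes the plane [x1 = x2 = 0] pointwise.  So the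
    hypothesis says that [D] is squarefree, and then [E : s^2 = D(t)] is a
    curve of genus one in [X], fixed pointwise by [G].  As [n] is even, [G]
    contains the Klein four-group of [T = diag(-1,-1,1,1,1)] and the swap [S]
    of [x1] and [x2]; so does [Aut(X)].  Already the action of this four-group
    is not linearizable ([no_klein_linearisation]).

    Suppose that [X] is equivariantly birational to a linear projective space,
    and choose coordinates there that are eigenvectors of [T] and [S].
    Vanishing along the surface fixed by an involution, then along [E], is a
    valuation of rank two on [k(X)] with residue field [k(E)], and an element
    of the group multiplies leading terms by signs that depend on the parity
    of the valuation.  The action on [X] is faithful, so two ratios [t1], [t2]
    of coordinates have valuations that are independent modulo 2
    ([involution_separates], [independent_leads]).  But [k(X) = k(t1,t2,t3)],
    and when [v(t1)] and [v(t2)] are independent the restriction of [v] to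
    [k(t1,t2)] has residue field [k], which is algebraically closed; by the
    ruled residue theorem the residue field of [k(t1,t2,t3)] lies in a rational
    function field [k(w)] ([mleadc_eval_rational], [rational_leads]).  Hence
    [E] would have a nonconstant point over [k(w)], which a degree count with
    a Wronskian excludes ([quartic_frac_const], [no_rational_parametrisation]).

    To make this concrete, let [th^2 = D(t)].  If [X1 X2 + S^2 = 1] then
    [(th X1, th X2, th S, t)] lies on the chart; parametrising that quadric
    near [(0,0,1)] maps [k[x1..x5]] to polynomials in three variables over a
    field containing [t] and [th], and the kernel of this ring morphism consists
    of the polynomials that vanish on [X] ([pullback_eq0P]).  The valuation
    becomes the leading monomial, the residue becomes the leading coefficient,
    and [T] and [S] become changes of sign of the variables. *)

(** * Square values of a nonsingular binary quartic *)

Lemma natr_injective (R : nzRingType) : (forall m, (m.+1)%:R != 0 :> R) ->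
  injective (fun m => m%:R : R).
Proof.
move=> R0 i j; wlog le : i j / (i <= j)%N => [th|] /eqP.
  by have [/th|/ltnW/th th' /eqP/esym/th' ->] := leqP i j; first move=> th' /eqP/th'.
rewrite eq_sym -subr_eq0 -natrB // => ij; apply/eqP; rewrite eqn_leq le -subn_eq0.
by case: (j - i)%N ij => // m /eqP E; have := R0 m; rewrite E eqxx.
Qed.

Section Genus.
Variable k : closedFieldType.
Hypothesis char0 : [pchar k] =i pred0.

Definition quartic (R : comNzRingType) (c4 c3 c2 c1 c0 : R) (p q : R) : R :=
  c4 * p ^+ 4 + c3 * (p ^+ 3 * q) + c2 * (p ^+ 2 * q ^+ 2) + c1 * (p * q ^+ 3)
  + c0 * q ^+ 4.

(** The partial derivatives of the quartic form in its two arguments. *)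
Definition quartic_d1 (R : comNzRingType) (c4 c3 c2 c1 : R) (p q : R) : R :=
  4 * c4 * p ^+ 3 + 3 * c3 * (p ^+ 2 * q) + 2 * c2 * (p * q ^+ 2) + c1 * q ^+ 3.

Definition quartic_d2 (R : comNzRingType) (c3 c2 c1 c0 : R) (p q : R) : R :=
  c3 * p ^+ 3 + 2 * c2 * (p ^+ 2 * q) + 3 * c1 * (p * q ^+ 2) + 4 * c0 * q ^+ 3.

(** By Euler's relation, a common zero of the two derivatives is a multiple root
    of the form; so this says that the form has four distinct roots on the
    projective line. *)
Definition nonsing_quartic (c4 c3 c2 c1 c0 : k) : Prop :=
  forall x y : k, quartic_d1 c4 c3 c2 c1 x y = 0 -> quartic_d2 c3 c2 c1 c0 x y = 0 ->
  x = 0 /\ y = 0.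

Lemma rmorph_quartic (R S : comNzRingType) (f : {rmorphism R -> S}) (c4 c3 c2 c1 c0 p q : R) :
  f (quartic c4 c3 c2 c1 c0 p q)
  = quartic (f c4) (f c3) (f c2) (f c1) (f c0) (f p) (f q).
Proof. by rewrite /quartic !(rmorphD, rmorphM, rmorphXn). Qed.

Lemma rmorph_quartic_d1 (R S : comNzRingType) (f : {rmorphism R -> S}) (c4 c3 c2 c1 p q : R) :
  f (quartic_d1 c4 c3 c2 c1 p q) = quartic_d1 (f c4) (f c3) (f c2) (f c1) (f p) (f q).
Proof. by rewrite /quartic_d1 !(rmorphD, rmorphM, rmorphXn, rmorph1). Qed.

Lemma rmorph_quartic_d2 (R S : comNzRingType) (f : {rmorphism R -> S}) (c3 c2 c1 c0 p q : R) :
  f (quartic_d2 c3 c2 c1 c0 p q) = quartic_d2 (f c3) (f c2) (f c1) (f c0) (f p) (f q).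
Proof. by rewrite /quartic_d2 !(rmorphD, rmorphM, rmorphXn, rmorph1). Qed.

Lemma natrS_neq0 (m : nat) : (m.+1)%:R != 0 :> k.
Proof. by move/pcharf0P: char0 => ->. Qed.

Let wronskian (p q : {poly k}) := p^`() * q - p * q^`().

(** Differentiating [Q(p, q) = r^2] and Euler's relation express the products of
    the Wronskian with [Q_1(p, q)] and with [Q_2(p, q)] as multiples of [r].
    Since [Q] is nonsingular and [p], [q] have no common root, [r] is coprime
    to the gcd of [Q_1(p, q)] and [Q_2(p, q)]. *)
Lemma sqrt_dvd_wronskian (c4 c3 c2 c1 c0 : k) (p q r : {poly k}) :
  nonsing_quartic c4 c3 c2 c1 c0 -> coprimep p q ->
  quartic c4%:P c3%:P c2%:P c1%:P c0%:P p q = r ^+ 2 ->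
  r %| wronskian p q.
Proof.
move=> ns cpq E.
pose dl := quartic_d1 c4%:P c3%:P c2%:P c1%:P p q.
pose dr := quartic_d2 c3%:P c2%:P c1%:P c0%:P p q.
have dE : dl * p^`() + dr * q^`() = 2 * r * r^`().
  have -> : dl * p^`() + dr * q^`()
    = (quartic c4%:P c3%:P c2%:P c1%:P c0%:P p q)^`().
    by rewrite /quartic !derivE /= /dl /dr /quartic_d1 /quartic_d2; ring.
  by rewrite E !derivE /=; ring.
have eul : dl * p + dr * q = 4 * r ^+ 2.
  rewrite -E /dl /dr /quartic_d1 /quartic_d2 /quartic; ring.
have d1 : r %| dl * wronskian p q.
  apply/dvdpP; exists (2 * r^`() * q - 4 * r * q^`()).
  have -> : dl * wronskian p q
    = (dl * p^`() + dr * q^`()) * q - (dl * p + dr * q) * q^`().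
    by rewrite /wronskian; ring.
  by rewrite dE eul; ring.
have d2 : r %| dr * wronskian p q.
  apply/dvdpP; exists (4 * r * p^`() - 2 * r^`() * p).
  have -> : dr * wronskian p q
    = (dl * p + dr * q) * p^`() - (dl * p^`() + dr * q^`()) * p.
    by rewrite /wronskian; ring.
  by rewrite dE eul; ring.
have cp : coprimep r (gcdp dl dr).
  apply/Pdiv.ClosedField.coprimepP => x rx; rewrite -[_ == 0]/(root _ x) root_gcd.
  apply/negP => /andP [/eqP dlx /eqP drx].
  move: dlx drx; rewrite -![_.[x]]/(horner_eval x _) rmorph_quartic_d1
    rmorph_quartic_d2 /= /horner_eval !hornerC => dlx drx.
  have [px qx] := ns p.[x] q.[x] dlx drx.
  have := coprimep_root cpq (_ : root p x); rewrite /root px eqxx => /(_ isT).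
  by rewrite qx eqxx.
rewrite -(Gauss_dvdpr _ cp) (eqp_dvdr _ (mulp_gcdl dl dr (wronskian p q))).
by rewrite dvdp_gcd d1 d2.
Qed.

Lemma size_wronskian (p q : {poly k}) : p != 0 -> q != 0 ->
  (size (wronskian p q) <= (size p).-1 + (size q).-1)%N.
Proof.
move=> p0 q0; apply: leq_trans (size_polyD _ _) _.
have sp : (0 < size p)%N by rewrite size_poly_gt0.
have sq : (0 < size q)%N by rewrite size_poly_gt0.
have dp := lt_size_deriv p0; have dq := lt_size_deriv q0.
have arith (a b c : nat) : (c < b -> 0 < a -> (c + a).-1 <= b.-1 + a.-1)%N by lia.
rewrite size_polyN geq_max; apply/andP; split.
- by apply: leq_trans (size_polyMleq _ _) _; apply: arith.
- by rewrite mulrC; apply: leq_trans (size_polyMleq _ _) _; rewrite [X in (_ <= X)%N]addnC; apply: arith.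
Qed.

(** As [deg q < deg p], the terms of the form have decreasing degrees in the
    order in which they are written; the first one is [p^4], or [p^3 q] if
    [c4 = 0]. *)
Lemma size_quartic (c4 c3 c2 c1 c0 : k) (p q : {poly k}) :
  q != 0 -> (size q < size p)%N -> (c4 != 0) || (c3 != 0) ->
  (3 * (size p).-1 + (size q).-1 + 1 <=
   size (quartic c4%:P c3%:P c2%:P c1%:P c0%:P p q))%N.
Proof.
move=> q0 sqp c43.
have p0 : p != 0 by rewrite -size_poly_gt0; lia.
have sp : (0 < size p)%N by rewrite size_poly_gt0.
have sq : (0 < size q)%N by rewrite size_poly_gt0.
pose a := (size p).-1; pose b := (size q).-1.
have sE i j : size (p ^+ i * q ^+ j) = (i * a + j * b).+1.
  have pi : p ^+ i != 0 by rewrite expf_neq0.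
  have qj : q ^+ j != 0 by rewrite expf_neq0.
  rewrite size_mul // -(prednK (_ : 0 < size (p ^+ i))%N) ?size_poly_gt0 //.
  rewrite -(prednK (_ : 0 < size (q ^+ j))%N) ?size_poly_gt0 // !size_exp /a /b.
  by rewrite addSn addnS /= mulnC [X in (_ + X)%N]mulnC.
have sC (c : k) i j : (size (c%:P * (p ^+ i * q ^+ j))%R <= (i * a + j * b).+1)%N.
  by rewrite mul_polyC; apply: leq_trans (size_scale_leq _ _) _; rewrite sE.
have sCE (c : k) i j : c != 0 -> size (c%:P * (p ^+ i * q ^+ j))%R = (i * a + j * b).+1.
  by move=> cn; rewrite mul_polyC size_scale // sE.
have -> : quartic c4%:P c3%:P c2%:P c1%:P c0%:P p q
   = c4%:P * (p ^+ 4 * q ^+ 0) + (c3%:P * (p ^+ 3 * q ^+ 1) +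
     (c2%:P * (p ^+ 2 * q ^+ 2) + (c1%:P * (p ^+ 1 * q ^+ 3)
       + c0%:P * (p ^+ 0 * q ^+ 4)))).
  by rewrite /quartic; ring.
have ab : (b < a)%N by rewrite /a /b; lia.
have s10 : (size (c1%:P * (p ^+ 1 * q ^+ 3) + c0%:P * (p ^+ 0 * q ^+ 4))%R
   <= (a + 3 * b).+1)%N.
  apply: leq_trans (size_polyD _ _) _; rewrite geq_max.
  by apply/andP; split; apply: leq_trans (sC _ _ _) _; lia.
have s20 : (size (c2%:P * (p ^+ 2 * q ^+ 2) + (c1%:P * (p ^+ 1 * q ^+ 3)
    + c0%:P * (p ^+ 0 * q ^+ 4)))%R <= (2 * a + 2 * b).+1)%N.
  apply: leq_trans (size_polyD _ _) _; rewrite geq_max.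
  apply/andP; split; first by apply: leq_trans (sC _ _ _) _; lia.
  by apply: leq_trans s10 _; lia.
have [c40|c40] := eqVneq c4 0.
  rewrite c40 eqxx /= in c43.
  rewrite c40 mul0r add0r size_polyDl ?sCE //; first lia.
  by apply: leq_ltn_trans s20 _; lia.
rewrite size_polyDl; first by rewrite (sCE c4) //; lia.
apply: leq_ltn_trans (size_polyD _ _) _; rewrite gtn_max (sCE c4) //.
apply/andP; split; first by apply: leq_ltn_trans (sC _ _ _) _; lia.
by apply: leq_ltn_trans s20 _; lia.
Qed.

Lemma deriv_eq0 (p : {poly k}) : p^`() = 0 -> (size p <= 1)%N.
Proof.
move=> /polyP dp; apply/leq_sizeP => -[//|j] _.
have := dp j; rewrite coef_deriv coef0 => /eqP.
by rewrite -mulr_natr mulf_eq0 (negbTE (natrS_neq0 j)) orbF => /eqP.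
Qed.

Lemma wronskian_eq0 (p q : {poly k}) : coprimep p q -> wronskian p q = 0 ->
  (size p <= 1)%N /\ (size q <= 1)%N.
Proof.
move=> cpq /eqP; rewrite subr_eq0 => /eqP E.
have small (u v : {poly k}) : coprimep u v -> u^`() * v = u * v^`() -> (size u <= 1)%N.
  move=> cuv Euv; have : u %| u^`() * v by rewrite Euv dvdp_mulr.
  rewrite Gauss_dvdpl // => du; apply: deriv_eq0; apply/eqP/negPn/negP => du0.
  have u0 : u != 0 by apply: contra_neq du0 => ->; rewrite deriv0.
  by have := dvdp_leq du0 du; rewrite leqNgt lt_size_deriv.
split; first exact: small cpq E.
by apply: (small q p); [rewrite coprimep_sym|rewrite [LHS]mulrC -E mulrC].
Qed.

(** Twice the degree of [r] is at least [3 deg p + deg q], whereas the degree of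
    a nonzero Wronskian is at most [deg p + deg q - 1]; so [r] can divide only
    a zero Wronskian. *)
Lemma wronskian_eq0_lt (c4 c3 c2 c1 c0 : k) (p q r : {poly k}) :
  nonsing_quartic c4 c3 c2 c1 c0 -> coprimep p q -> (size q < size p)%N ->
  quartic c4%:P c3%:P c2%:P c1%:P c0%:P p q = r ^+ 2 ->
  wronskian p q = 0.
Proof.
move=> ns cpq sqp E; apply/eqP/negPn/negP => W0.
have p0 : p != 0 by rewrite -size_poly_gt0; lia.
have q0 : q != 0.
  apply: contraNneq W0 => q0; move: cpq.
  rewrite /wronskian q0 mulr0 sub0r deriv0 mulr0 oppr0 eqxx //.
have c43 : (c4 != 0) || (c3 != 0).
  rewrite -negb_and; apply/negP => /andP [/eqP c40 /eqP c30].
  have [] := ns 1 0.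
  - by rewrite /quartic_d1 c40 c30; ring.
  - by rewrite /quartic_d2 c30; ring.
  - by move/eqP; rewrite oner_eq0.
have := size_quartic c2 c1 c0 q0 sqp c43; rewrite E.
have := leq_trans (dvdp_leq W0 (sqrt_dvd_wronskian ns cpq E)) (size_wronskian p0 q0).
have := size_exp r 2; have : (0 < size q)%N by rewrite size_poly_gt0.
move: (size p) (size q) (size r) (size (r ^+ 2)) sqp => sp sq sr sr2; lia.
Qed.

(** The condition [size q < size p] is reached by exchanging [p] and [q], after
    subtracting from [p] a multiple of [q] if the sizes are equal. *)
Lemma quartic_sqr_const (c4 c3 c2 c1 c0 : k) (p q r : {poly k}) :
  nonsing_quartic c4 c3 c2 c1 c0 -> coprimep p q ->
  quartic c4%:P c3%:P c2%:P c1%:P c0%:P p q = r ^+ 2 ->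
  (size p <= 1)%N /\ (size q <= 1)%N.
Proof.
have swap d4 d3 d2 d1 d0 : nonsing_quartic d4 d3 d2 d1 d0 -> nonsing_quartic d0 d1 d2 d3 d4.
  move=> ns x y xl yr; have [|//|-> ->] := ns y x.
  - by rewrite -yr /quartic_d1 /quartic_d2; ring.
  - by rewrite -xl /quartic_d1 /quartic_d2; ring.
  by [].
move=> ns cpq E; apply: wronskian_eq0 => //.
have [spq|sqp|spq] := ltngtP (size p) (size q).
- apply/eqP; rewrite -oppr_eq0 opprB; apply/eqP.
  rewrite [X in X - _]mulrC [X in _ - X]mulrC.
  apply: (@wronskian_eq0_lt c0 c1 c2 c3 c4 q p r); [exact: swap|by rewrite coprimep_sym|by []|].
  by rewrite -E /quartic; ring.
- exact: wronskian_eq0_lt ns cpq sqp E.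
have [p0|p0] := eqVneq p 0; first by rewrite /wronskian p0 deriv0 !mul0r subr0.
have q0 : q != 0 by rewrite -size_poly_gt0 -spq size_poly_gt0.
pose l := lead_coef p / lead_coef q; pose p1 := p - l%:P * q.
have pE : p = p1 + l%:P * q by rewrite /p1 subrK.
have l0 : l != 0 by rewrite mulf_neq0 ?invr_eq0 ?lead_coef_eq0.
have sp1 : (size p1 < size q)%N.
  have sq : (0 < size q)%N by rewrite size_poly_gt0.
  rewrite -(prednK sq) ltnS; apply/leq_sizeP => j hj.
  rewrite /p1 coefB coefCM.
  have [->|nj] := eqVneq j (size q).-1.
    by rewrite -{1}spq -!lead_coefE /l divfK ?subrr // lead_coef_eq0.
  have sqj : (size q <= j)%N.
    by rewrite -(prednK sq) ltn_neqAle eq_sym nj hj.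
  by rewrite !nth_default ?mulr0 ?subr0 // spq.
have -> : wronskian p q = - wronskian q p1.
  by rewrite /wronskian pE !derivE; ring.
apply/eqP; rewrite oppr_eq0; apply/eqP.
(* the coefficients of the form in the coordinates q, p1, where p = p1 + l q *)
apply: (@wronskian_eq0_lt
   (c4 * l ^+ 4 + c3 * l ^+ 3 + c2 * l ^+ 2 + c1 * l + c0)
   (4 * c4 * l ^+ 3 + 3 * c3 * l ^+ 2 + 2 * c2 * l + c1)
   (6 * c4 * l ^+ 2 + 3 * c3 * l + c2) (4 * c4 * l + c3) c4 q p1 r) => //.
- apply: swap => x y xl yr; have [||u v] := ns (x + l * y) y.
  + by rewrite -xl /quartic_d1; ring.
  + have -> : quartic_d2 c3 c2 c1 c0 (x + l * y) y =
      quartic_d2 (4 * c4 * l + c3) (6 * c4 * l ^+ 2 + 3 * c3 * l + c2)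
       (4 * c4 * l ^+ 3 + 3 * c3 * l ^+ 2 + 2 * c2 * l + c1)
       (c4 * l ^+ 4 + c3 * l ^+ 3 + c2 * l ^+ 2 + c1 * l + c0) x y
      - l * quartic_d1 c4 (4 * c4 * l + c3) (6 * c4 * l ^+ 2 + 3 * c3 * l + c2)
       (4 * c4 * l ^+ 3 + 3 * c3 * l ^+ 2 + 2 * c2 * l + c1) x y.
      by rewrite /quartic_d1 /quartic_d2; ring.
    by rewrite xl yr; ring.
  + by move: u; rewrite v mulr0 addr0.
- by move: cpq; rewrite {1}pE coprimep_sym addrC coprimep_addl_mul.
- rewrite -E pE /quartic !(polyCD, polyCM, polyC_exp); ring.
Qed.

(** A double cover of the line branched at four points has no nonconstant point
    over a rational function field.  Common factors of [p] and [q] can be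
    removed because the form has even degree. *)
Lemma quartic_frac_const (c4 c3 c2 c1 c0 : k) (p q r : {poly k}) :
  nonsing_quartic c4 c3 c2 c1 c0 -> q != 0 ->
  quartic c4%:P c3%:P c2%:P c1%:P c0%:P p q = r ^+ 2 ->
  exists c : k, p = c *: q.
Proof.
move=> ns q0 E.
pose d := gcdp p q; pose p' := p %/ d; pose q' := q %/ d.
have d0 : d != 0 by rewrite gcdp_eq0 negb_and q0 orbT.
have pE : p = p' * d by rewrite divpK // dvdp_gcdl.
have qE : q = q' * d by rewrite divpK // dvdp_gcdr.
have cpq : coprimep p' q' by apply: coprimep_div_gcd; rewrite q0 orbT.
have EE : (d ^+ 2) ^+ 2 * quartic c4%:P c3%:P c2%:P c1%:P c0%:P p' q' = r ^+ 2.
  by rewrite -E pE qE /quartic; ring.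
have v0 : d ^+ 2 != 0 by rewrite expf_neq0.
have : (d ^+ 2) ^+ 2 %| r ^+ 2 by rewrite -EE dvdp_mulr.
rewrite dvdp_pexp2r // => /dvdpP [s rE].
have [|sp sq] := @quartic_sqr_const c4 c3 c2 c1 c0 p' q' s ns cpq.
  apply: (mulfI (expf_neq0 2 v0)); rewrite EE rE; ring.
have q'0 : q' != 0 by apply: contraNneq q0 => q'0; rewrite qE q'0 mul0r.
have q'C := size1_polyC sq; have q'00 : q'`_0 != 0 by rewrite -polyC_eq0 -q'C.
exists (p'`_0 / q'`_0).
rewrite [p in LHS]pE [q in RHS]qE [p' in LHS](size1_polyC sp) [in RHS]q'C coefC /=.
by rewrite -!mul_polyC mulrA -polyCM divfK.
Qed.

End Genus.

(** * Leading coefficients of polynomials over a ruled residue field *)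

Lemma classical_minimizer (T : Type) (sz : T -> nat) (P : T -> Prop) :
  (exists x, P x) -> exists2 x, P x & forall y, (sz y < sz x)%N -> ~ P y.
Proof.
move=> [x Px]; have [n] := ubnP (sz x); elim: n x Px => // n IH x Px.
rewrite ltnS => sx.
have [[y [sy Py]]|no] := classic (exists y, (sz y < sz x)%N /\ P y).
  by apply: (IH y) => //; apply: leq_trans sx.
by exists x => // y sy Py; apply: no; exists y.
Qed.

Lemma mlead_unique (K : fieldType) (n : nat) (p : {mpoly K[n]}) (g : 'X_{1..n}) :
  p@_g != 0 -> (forall m, (g < m)%O -> p@_m = 0) -> mlead p = g.
Proof.
move=> pg above; have [lt|gt|//] := ltgtP (mlead p) g.
  by move: pg; rewrite (mcoeff_gt_mlead lt) eqxx.
have := above _ gt; move/eqP; rewrite mleadc_eq0 => /eqP p0.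
by move: pg; rewrite p0 mcoeff0 eqxx.
Qed.

(** An element outside an algebraically closed subfield is transcendental over
    it. *)
Lemma root_const (k : closedFieldType) (K : fieldType) (iota : {rmorphism k -> K})
    (w : K) (r : {poly k}) :
  (forall a, w <> iota a) -> r != 0 -> (map_poly iota r).[w] != 0.
Proof.
move=> tw r0; have [rs rE] := closed_field_poly_normal r.
rewrite rE map_polyZ rmorph_prod hornerZ horner_prod mulf_neq0 //.
  by rewrite fmorph_eq0 lead_coef_eq0.
rewrite prodf_seq_neq0; apply/allP => a _ /=; rewrite rmorphB /= map_polyX map_polyC /= hornerXsubC.
by rewrite subr_eq0; apply/eqP/tw.
Qed.

(** The leading coefficient of [p] need not be invertible in [D], whence the
    denominator [d]. *)
Lemma base_expansion (D : idomainType) (p : {poly D}) : (1 < size p)%N ->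
  forall Q : {poly D}, exists2 d : D, d != 0 &
  exists2 s : seq {poly D}, (forall q, q \in s -> (size q < size p)%N) &
    d *: Q = \sum_(i < size s) s`_i * p ^+ i.
Proof.
move=> sp Q; have [n] := ubnP (size Q); elim: n Q => // n IH Q sQ.
have p0 : p != 0 by rewrite -size_poly_gt0; apply: ltn_trans sp.
have [lt|ge] := ltnP (size Q) (size p).
  exists 1; rewrite ?oner_eq0 //; exists [:: Q] => [q|].
    by rewrite inE => /eqP ->.
  by rewrite /= big_ord_recl big_ord0 /= expr0 mulr1 addr0 scale1r.
have sdiv : (size (Q %/ p)%R < n)%N.
  apply: leq_trans _ (sQ : (size Q <= n)%N); rewrite Pdiv.Idomain.size_divp // ?ltn_subrL.
  by rewrite -subn1 subn_gt0 sp /=; apply: leq_trans ge; apply: ltn_trans sp.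
have [d d0 [s ss E]] := IH _ sdiv.
exists (d * lead_coef p ^+ Pdiv.Idomain.scalp Q p).
  by rewrite mulf_neq0 // expf_neq0 // lead_coef_eq0.
exists ((d *: (Q %% p)) :: s) => [q|].
  rewrite inE => /orP[/eqP ->|]; last exact: ss.
  by apply: leq_ltn_trans (size_scale_leq _ _) _; rewrite Pdiv.Idomain.ltn_modp.
rewrite -scalerA Pdiv.Idomain.divp_eq scalerDr scalerAl E /= big_ord_recl /=.
rewrite expr0 mulr1 addrC mulr_suml; congr (_ + _).
by apply: eq_bigr => i _; rewrite /bump /= exprS mulrA mulrAC.
Qed.

Section Ruled.
Variables (k : closedFieldType) (D : idomainType) (K : fieldType) (n : nat).
Variables (iota : {rmorphism k -> K}) (beta : {rmorphism D -> {mpoly K[n]}}).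
Hypothesis beta_neq0 : forall d, d != 0 -> beta d != 0.
Hypothesis beta_const : forall d, exists c, mleadc (beta d) = iota c.
Variable b : {mpoly K[n]}.

Let ev (Q : {poly D}) : {mpoly K[n]} := (map_poly beta Q).[b].
Let evD : {morph ev : x y / x + y}.
Proof. by move=> x y; rewrite /ev rmorphD hornerD. Qed.
Let evM : {morph ev : x y / x * y}.
Proof. by move=> x y; rewrite /ev rmorphM hornerM. Qed.
Let ev0 : ev 0 = 0.
Proof. by rewrite /ev rmorph0 horner0. Qed.
Let ev1 : ev 1 = 1.
Proof. by rewrite /ev rmorph1 hornerC. Qed.
Let evC d : ev d%:P = beta d.
Proof. by rewrite /ev map_polyC hornerC. Qed.

(** The ruled residue theorem over an algebraically closed residue field [k].
    Let [p] have least degree among the polynomials over [D] whose value at [b]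
    has a leading coefficient [w] outside [k].  In a [p]-adic expansion all
    digits have leading coefficients in [k], and leading terms of the same
    monomial add up to a nonzero polynomial in [w] because [w] is
    transcendental over [k]. *)
Lemma mleadc_eval_rational :
  exists w : K, forall Q, exists r : {poly k}, mleadc (ev Q) = (map_poly iota r).[w].
Proof.
have [all_const|] := classic (forall Q, exists c, mleadc (ev Q) = iota c).
  exists 0 => Q; have [c ->] := all_const Q.
  by exists c%:P; rewrite map_polyC hornerC.
move/not_all_ex_not/(classical_minimizer (fun Q : {poly D} => size Q)) => [p tp small].
have tw a : mleadc (ev p) <> iota a by move=> E; apply: tp; exists a.
have {}small (q : {poly D}) : (size q < size p)%N -> exists c, mleadc (ev q) = iota c.
  by move=> /small/NNPP.
set w := mleadc (ev p) in tw; exists w => Q.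
have P0 : ev p != 0.
  by apply/eqP => P0; apply: (tw 0); rewrite /w P0 mcoeff0 rmorph0.
have sp : (1 < size p)%N.
  rewrite ltnNge; apply/negP => /size1_polyC pC.
  by have [c E] := beta_const p`_0; apply: (tw c); rewrite /w pC evC.
have [d d0 [s ss dQ]] := base_expansion sp Q.
have evdQ : beta d * ev Q = \sum_(i < size s) ev s`_i * ev p ^+ i.
  rewrite -evC -evM mul_polyC dQ (big_morph ev evD ev0); apply: eq_bigr => i _.
  rewrite evM; congr (_ * _); elim: (nat_of_ord i) => [|m IH]; first by rewrite !expr0 ev1.
  by rewrite !exprS evM IH.
suff [r rE] : exists r : {poly k},
    mleadc (\sum_(i < size s) ev s`_i * ev p ^+ i) = (map_poly iota r).[w].
  have [c cE] := beta_const d.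
  have c0 : iota c != 0 by rewrite -cE mleadc_eq0 beta_neq0.
  exists (c^-1 *: r); rewrite map_polyZ hornerZ -rE -evdQ fmorphV.
  have [->|Q0] := eqVneq (ev Q) 0; first by rewrite mulr0 mcoeff0 mulr0.
  by rewrite mleadM ?beta_neq0 // mleadcM cE mulKf.
pose a (i : 'I_(size s)) := ev s`_i * ev p ^+ i.
have [allz|] := boolP [forall i, a i == 0].
  exists 0; rewrite rmorph0 horner0 big1 ?mcoeff0 // => i _.
  by apply/eqP/(forallP allz).
rewrite negb_forall => /existsP [i0 ai0].
case: (@arg_maxP _ _ _ i0 (fun i => a i != 0) (fun i => mlead (a i)) ai0) => i1 ai1 imax.
(* only the terms whose leading monomial is the largest one contribute *)
set g := mlead (a i1).
have above i m : (g < m)%O -> (a i)@_m = 0.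
  move=> gm; have [->|/imax le] := eqVneq (a i) 0; first by rewrite mcoeff0.
  by apply: mcoeff_gt_mlead; apply: le_lt_trans gm.
have coefg i : exists c, (a i)@_g = iota c * w ^+ i.
  have [ai|ai] := eqVneq (a i) 0.
    by exists 0; rewrite ai mcoeff0 rmorph0 mul0r.
  have : (mlead (a i) <= g)%O := imax _ ai.
  rewrite le_eqVlt => /orP [/eqP mE|lt]; last first.
    by exists 0; rewrite (mcoeff_gt_mlead lt) rmorph0 mul0r.
  have [|c cE] := small s`_i; first by apply: ss; rewrite mem_nth.
  have si0 : ev s`_i != 0 by apply: contraNneq ai; rewrite /a => ->; rewrite mul0r.
  have Pi0 : ev p ^+ i != 0 by rewrite expf_neq0.
  by exists c; rewrite -mE /a mleadM // mleadcM cE mleadX // mleadcX.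
have [c cE] := fin_all_exists coefg.
pose r : {poly k} := \sum_i c i *: 'X^i.
have rw : (map_poly iota r).[w] = (\sum_i a i)@_g.
  rewrite rmorph_sum horner_sum raddf_sum; apply: eq_bigr => i _ /=.
  by rewrite map_polyZ map_polyXn hornerZ hornerXn cE.
have r0 : r != 0.
  apply/eqP => /polyP /(_ i1); rewrite coef0 coef_sum (bigD1 i1) //= big1 => [|i ne].
    rewrite coefZ coefXn eqxx mulr1 addr0 => c0.
    have := ai1; rewrite -mleadc_eq0 -/g cE c0 rmorph0 mul0r eqxx //.
  by rewrite coefZ coefXn eq_sym -[_ == _ :> nat]/(i == i1) (negbTE ne) mulr0.
exists r; rewrite rw; congr (_@_ _).
apply: mlead_unique; first by rewrite -rw root_const.
by move=> m gm; rewrite raddf_sum big1 // => i _; apply: above.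
Qed.

End Ruled.

(** * Adjoining roots *)

Lemma irreducible_divisor (F : fieldType) (p : {poly F}) : (1 < size p)%N ->
  exists2 q : {poly F}, irreducible_poly q & q %| p.
Proof.
move=> sp; have p0 : p != 0 by rewrite -size_poly_gt0; apply: ltn_trans sp.
have [|q [sq qp] qmin] :=
  @classical_minimizer {poly F} (fun q => size q) (fun q => (1 < size q)%N /\ q %| p).
  by exists p.
exists q => //; split=> // d sd dq.
have q0 : q != 0 by rewrite -size_poly_gt0; apply: ltn_trans sq.
have d0 : d != 0 by apply: contraTneq dq => ->; rewrite dvd0p.
rewrite -dvdp_size_eqp // eqn_leq dvdp_leq //= leqNgt; apply/negP => lt.
by apply: (qmin d lt); split; [rewrite ltn_neqAle eq_sym sd size_poly_gt0|exact: dvdp_trans qp].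
Qed.

Lemma root_extension (F : fieldType) (p : {poly F}) : (1 < size p)%N ->
  exists (L : fieldType) (i : {rmorphism F -> L}) (z : L), root (map_poly i p) z.
Proof.
move=> /irreducible_divisor [q irr /dvdpP [u ->]].
have [L _ [z rz _]] := irredp_FAdjoin irr.
exists L, (in_alg L), z; rewrite rmorphM /= rootM rz orbT //.
Qed.

Lemma roots_extension (F : fieldType) (N : nat) (s : seq F) : (0 < N)%N ->
  exists (L : fieldType) (i : {rmorphism F -> L}),
  forall a, a \in s -> exists z : L, z ^+ N = i a.
Proof.
move=> N0; elim: s => [|a s [L [i IH]]]; first by exists F, idfun.
have [|L' [j [z rz]]] := @root_extension L ('X^N - (i a)%:P).
  by rewrite size_XnsubC.
exists L', (j \o i) => c; rewrite inE => /orP [/eqP ->|/IH [y yE]].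
  exists z; move: rz; rewrite rmorphB /= map_polyXn map_polyC /= /root !hornerE.
  by rewrite subr_eq0 => /eqP.
by exists (j y); rewrite -rmorphXn /= yE.
Qed.

(** With [N] the absolute value of the determinant, the adjugate of [B] gives
    a solution in terms of [N]-th roots of the [mu i]. *)
Lemma monomial_system (F : fieldType) (n : nat) (B : 'I_n -> 'I_n -> nat) (mu : 'I_n -> F) :
  \det (\matrix_(i, j) (B i j)%:Z) != 0 -> (forall i, mu i != 0) ->
  exists (L : fieldType) (phi : {rmorphism F -> L}) (alpha : 'I_n -> L),
    (forall j, alpha j != 0) /\
    forall i, \prod_j alpha j ^+ B i j = phi (mu i).
Proof.
set M := \matrix_(i, j) _ => dM mu0.
have [|L [phi rts]] := @roots_extension F `|\det M|%N [seq mu i | i <- enum 'I_n].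
  by rewrite absz_gt0.
have [beta bE] : exists beta : 'I_n -> L, forall i, beta i ^+ `|\det M|%N = phi (mu i).
  apply: (@fin_all_exists _ (fun=> L) (fun i z => z ^+ `|\det M|%N = phi (mu i))) => i.
  by apply: rts; rewrite map_f // mem_enum.
have b0 i : beta i != 0.
  apply/eqP => bi; have := bE i; rewrite bi expr0n absz_eq0 (negbTE dM).
  by move/esym/eqP; rewrite fmorph_eq0 (negbTE (mu0 i)).
exists L, phi, (fun j => \prod_l beta l ^ (sgz (\det M) * \adj M j l)); split.
  by move=> j; apply/prodf_neq0 => l _; rewrite expfz_neq0.
move=> i; rewrite -bE.
have collect l : \prod_j (beta l ^ (sgz (\det M) * \adj M j l)) ^+ B i j
    = beta l ^ (sgz (\det M) * (M *m \adj M) i l).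
  rewrite mxE mulr_sumr.
  rewrite (big_morph (fun m : int => beta l ^ m)
    (fun x y => @expfzDr _ (beta l) x y (b0 l)) (expr0z (beta l))).
  apply: eq_bigr => j _; rewrite [M i j]mxE exprnP exprz_exp.
  by rewrite -mulrA [\adj M j l * _]mulrC.
under eq_bigr => j _ do rewrite -prodrXl.
rewrite exchange_big /= (bigD1 i) //= [X in _ * X]big1 ?mulr1 => [|l li].
  by rewrite collect mul_mx_adj mxE eqxx mulr1n -abszEsg exprnP.
by rewrite collect mul_mx_adj mxE eq_sym (negbTE li) mulr0n mulr0 expr0z.
Qed.

(** * Polynomials vanishing on a graph *)

Lemma mpoly_ring_ind (R : nzRingType) (n : nat) (P : {mpoly R[n]} -> Prop) :
  (forall c, P c%:MP) -> (forall i, P 'X_i) ->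
  (forall p q, P p -> P q -> P (p + q)) -> (forall p q, P p -> P q -> P (p * q)) ->
  forall p, P p.
Proof.
move=> PC PX PD PM p; rewrite [p]mpolyE; elim/big_ind: _ => //; first exact: (PC 0).
move=> m _; rewrite -mul_mpolyC mpolyXE_id; apply: (PM) => //.
elim/big_ind: _ => //; first exact: (PC 1).
move=> i _; elim: (m i) => [|d IH]; first by rewrite expr0; exact: (PC 1).
by rewrite exprS; apply: PM.
Qed.

Lemma mpoly_rmorph_eq (R S : nzRingType) (n : nat) (f g : {rmorphism {mpoly R[n]} -> S}) :
  (forall c, f c%:MP = g c%:MP) -> (forall i, f 'X_i = g 'X_i) -> f =1 g.
Proof.
move=> fgC fgX; apply: mpoly_ring_ind => // p q pE qE.
  by rewrite !rmorphD pE qE.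
by rewrite !rmorphM pE qE.
Qed.

Lemma mmapXU (R S : comNzRingType) (n : nat) (f : {rmorphism R -> S}) (h : 'I_n -> S) i :
  mmap f h 'X_i = h i.
Proof. by rewrite mmapX mmap1U. Qed.

Lemma rmorph_mmap (R S T : comNzRingType) (n : nat) (f : {rmorphism R -> S})
    (h : 'I_n -> S) (g : {rmorphism S -> T}) p :
  g (mmap f h p) = mmap (g \o f) (g \o h) p.
Proof.
apply: (mpoly_rmorph_eq (f := g \o mmap f h)) => [c|i] /=.
  by rewrite !mmapC.
by rewrite !mmapXU.
Qed.

Lemma mmap_eq (R S : comNzRingType) (n : nat) (f g : {rmorphism R -> S}) (h h' : 'I_n -> S) p :
  f =1 g -> h =1 h' -> mmap f h p = mmap g h' p.
Proof.
move=> fg hh'; apply: (mpoly_rmorph_eq (f := mmap f h) (g := mmap g h')) => [c|i] /=.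
  by rewrite !mmapC; exact: fg.
by rewrite !mmapXU hh'.
Qed.

Section Infinite.
Variables (k : closedFieldType) (n : nat).
Implicit Types (p q : {mpoly k[n]}).

Definition subst (h : 'I_n -> {mpoly k[n]}) : {mpoly k[n]} -> {mpoly k[n]} :=
  mmap (@mpolyC n k) h.
HB.instance Definition _ h := GRing.RMorphism.on (subst h).

Lemma substXU h i : subst h 'X_i = h i.
Proof. exact: mmapXU. Qed.

Lemma substC h c : subst h c%:MP = c%:MP.
Proof. by rewrite /subst mmapC. Qed.

Lemma subst_id p : subst (fun i => 'X_i) p = p.
Proof.
apply: (mpoly_rmorph_eq (f := subst _) (g := idfun)) => [c|i] /=.
  by rewrite substC.
by rewrite substXU.
Qed.

Lemma meval_subst h v p : (subst h p).@[v] = p.@[fun i => (h i).@[v]].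
Proof.
apply: (mpoly_rmorph_eq (f := meval v \o subst h) (g := meval _)) => [c|i] /=.
  by rewrite substC !mevalC.
by rewrite substXU mevalXU.
Qed.

Hypothesis char0 : [pchar k] =i pred0.

Lemma const_nonroot (A : idomainType) (f : {rmorphism k -> A}) (P : {poly A}) :
  P != 0 -> exists c, P.[f c] != 0.
Proof.
move=> P0; pose s := [seq f i%:R | i <- iota 0 (size P)].
have us : uniq s.
  rewrite map_inj_uniq ?iota_uniq // => i j /fmorph_inj.
  exact: (natr_injective (natrS_neq0 char0)).
have [/(max_poly_roots P0)/(_ us)|] := boolP (all (root P) s).
  by rewrite size_map size_iota ltnn.
by case/allPn => _ /mapP[i _ ->] ri; exists i%:R.
Qed.

(** The variables are specialised one after the other, each time regarding the
    polynomial as univariate in the variable to be specialised. *)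
Lemma mpoly_nonroot p : p != 0 -> exists v : 'I_n -> k, p.@[v] != 0.
Proof.
move=> p0.
have [v pv] : exists v : 'I_n -> k,
    subst (fun i => if i \in enum 'I_n then (v i)%:MP else 'X_i) p != 0.
  elim: (enum 'I_n) => [|j s [v IH]].
    exists (fun=> 0); rewrite (_ : subst _ p = p) // -[RHS]subst_id.
    exact: mmap_eq.
  pose u : {rmorphism _ -> {poly {mpoly k[n]}}} :=
    mmap (polyC \o @mpolyC n k) (fun i => if i == j then 'X else ('X_i)%:P).
  set q := subst _ p in IH.
  have uq : u q != 0.
    apply: contraNneq IH => uq0; rewrite -[q]subst_id.
    suff -> : subst (fun i => 'X_i) q = (horner_eval 'X_j \o u) q.
      by rewrite /= uq0 /horner_eval horner0.
    apply: mpoly_rmorph_eq => [c|i] /=.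
      by rewrite substC /= /horner_eval mmapC hornerC.
    by rewrite substXU /= /horner_eval mmapXU; case: eqP => [->|_]; rewrite ?hornerX ?hornerC.
  have [c cq] := const_nonroot (@mpolyC n k) uq.
  exists (fun i => if i \in s then v i else c).
  pose h i := if i \in s then (v i)%:MP else 'X_i : {mpoly k[n]}.
  suff -> : forall h', (forall i, h' i = if i \in j :: s then
     (if i \in s then v i else c)%:MP else 'X_i) ->
     subst h' p = (horner_eval c%:MP \o u \o subst h) p by [].
  move=> h' h'E; apply: mpoly_rmorph_eq => [a|i] /=.
    by rewrite substC /= /horner_eval substC mmapC hornerC.
  rewrite substXU h'E /= /horner_eval substXU /h inE.
  have [is_|is_] := boolP (i \in s); first by rewrite orbT mmapC hornerC.
  by rewrite orbF mmapXU; case: eqP => _; rewrite ?hornerX ?hornerC.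
exists v; apply: contraNneq pv => pv.
suff -> : forall h', (forall i, h' i = (v i)%:MP) ->
    subst h' p = (@mpolyC n k \o meval v) p.
- by rewrite /= pv.
- by move=> i; rewrite mem_enum.
move=> h' h'E; apply: mpoly_rmorph_eq => [c|i] /=.
  by rewrite substC /= mevalC.
by rewrite substXU h'E /= mevalXU.
Qed.

Definition erase (j : 'I_n) := subst (fun i => if i == j then 0 else 'X_i).
HB.instance Definition _ j := GRing.RMorphism.on (erase j).

Lemma eraseXU j i : erase j 'X_i = if i == j then 0 else 'X_i.
Proof. exact: substXU. Qed.

Lemma eraseC j c : erase j c%:MP = c%:MP.
Proof. exact: substC. Qed.

Lemma erase_dvd j p : exists q, p = erase j p + 'X_j * q.
Proof.
elim/mpoly_ring_ind: p => [c|i|p q [p' pE] [q' qE]|p q [p' pE] [q' qE]].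
- by exists 0; rewrite eraseC mulr0 addr0.
- rewrite eraseXU; case: eqP => [->|_]; first by exists 1; rewrite add0r mulr1.
  by exists 0; rewrite mulr0 addr0.
- by exists (p' + q'); rewrite rmorphD {1}pE {1}qE; ring.
exists (erase j p * q' + p' * erase j q + 'X_j * p' * q').
by rewrite rmorphM {1}pE {1}qE; ring.
Qed.

(** The variable [X_j] is prime and does not divide [F]. *)
Lemma cancel_var (F : {mpoly k[n]}) j p : erase j F != 0 ->
  (exists q, 'X_j * p = F * q) -> exists q, p = F * q.
Proof.
move=> F0 [q E]; have [q' qE] := erase_dvd j q.
have: erase j F * erase j q = 0.
  by rewrite -rmorphM -E rmorphM /= eraseXU eqxx mul0r.
move/eqP; rewrite mulf_eq0 (negbTE F0) /= => /eqP q0.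
exists q'; have Xj0 : 'X_j != 0 :> {mpoly k[n]}.
  by rewrite -msupp_eq0 msuppX.
by apply: (mulfI Xj0); rewrite E qE q0; ring.
Qed.

(** Modulo [F], the product [u X_j] can be replaced by [- q]. *)
Lemma graph_normal_form (F u q : {mpoly k[n]}) j :
  F = 'X_j * u + q -> erase j u = u -> erase j q = q ->
  forall p, exists N Q R, u ^+ N * p = F * Q + erase j R.
Proof.
move=> FE eu eq.
elim/mpoly_ring_ind => [c|i|p p' [N [Q [R E]]] [N' [Q' [R' E']]]|p p' [N [Q [R E]]] [N' [Q' [R' E']]]].
- by exists 0%N, 0, c%:MP; rewrite eraseC; ring.
- have [->|ij] := eqVneq i j.
    by exists 1%N, 1, (- q); rewrite rmorphN /= eq FE; ring.
  by exists 0%N, 0, 'X_i; rewrite eraseXU (negbTE ij); ring.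
- exists (N + N')%N, (u ^+ N' * Q + u ^+ N * Q'), (u ^+ N' * R + u ^+ N * R').
  rewrite rmorphD !rmorphM !rmorphXn /= eu exprD.
  transitivity (u ^+ N' * (u ^+ N * p) + u ^+ N * (u ^+ N' * p')); first by ring.
  by rewrite E E'; ring.
exists (N + N')%N, (F * Q * Q' + Q * erase j R' + erase j R * Q'), (R * R').
rewrite rmorphM /= exprD.
transitivity ((u ^+ N * p) * (u ^+ N' * p')); first by ring.
by rewrite E E'; ring.
Qed.

(** Where [u] does not vanish, [F = 0] is the graph of [- q / u].  A remainder
    that does not involve [X_j] and vanishes on the graph is zero. *)
Lemma vanish_on_graph (F u q p : {mpoly k[n]}) j :
  F = 'X_j * u + q -> erase j u = u -> erase j q = q -> u != 0 ->
  (forall v, F.@[v] = 0 -> u.@[v] != 0 -> p.@[v] = 0) ->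
  exists N Q, u ^+ N * p = F * Q.
Proof.
move=> FE eu eq u0 van.
have [N [Q [R E]]] := graph_normal_form FE eu eq p.
exists N, Q; rewrite E; suff -> : erase j R = 0 by rewrite addr0.
apply: (mulfI u0); rewrite mulr0; apply/eqP/negPn/negP => /mpoly_nonroot [v].
rewrite mevalM mulf_eq0 negb_or => /andP [uv Rv].
pose x := - q.@[v] / u.@[v]; pose v' i := if i == j then x else v i.
have ev r : (erase j r).@[v'] = (erase j r).@[v].
  rewrite !meval_subst; apply: meval_eq => i; rewrite /v'.
  by case: (altP (i =P j)) => ij; rewrite ?meval0 // !mevalXU (negbTE ij).
have uv' : u.@[v'] = u.@[v] by rewrite -eu ev.
have Fv' : F.@[v'] = 0.
  rewrite FE mevalD mevalM mevalXU /v' eqxx -/v' uv' -eq ev eq /x.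
  by rewrite divfK // addNr.
have := congr1 (meval v') E.
rewrite mevalM mevalD mevalM Fv' ev van ?uv' // mulr0 mul0r add0r => /esym/eqP.
by rewrite (negbTE Rv).
Qed.

End Infinite.

(** * The cubic threefold and a generic point of it *)

Definition vec5 (R : Type) (a b c d e : R) (i : 'I_5) : R := nth e [:: a; b; c; d] i.

Lemma comp_vec5 (R S : Type) (f : R -> S) (a b c d e : R) :
  f \o vec5 a b c d e =1 vec5 (f a) (f b) (f c) (f d) (f e).
Proof. by case; do 5?case. Qed.

Lemma vec5_eta (R : Type) (v : 'I_5 -> R) :
  v =1 vec5 (v (inord 0)) (v (inord 1)) (v (inord 2)) (v (inord 3)) (v (inord 4)).
Proof.
by case; do 5?case; move=> // lt; rewrite /vec5 /=; congr v; apply: val_inj; rewrite /= inordK.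
Qed.

(** The first family of cubics is the case [h = 1/2], [d3 = 0], the second one
    the case [h = 0], [d3 = 1], [e1 = 0].  For [x5 = 1] the form equals
    [x1 x2 + (x3 + h x4^2)^2 - branch x4]. *)
Definition cubic_form (R : comNzRingType) (h d3 e1 e2 e3 x1 x2 x3 x4 x5 : R) : R :=
  x1 * x2 * x5 + x5 * x3 ^+ 2 + 2 * h * (x3 * x4 ^+ 2) + d3 * x4 ^+ 3
  + e1 * (x4 ^+ 2 * x5) + e2 * (x4 * x5 ^+ 2) + e3 * x5 ^+ 3.

Lemma rmorph_cubic_form (R S : comNzRingType) (f : {rmorphism R -> S})
    (h d3 e1 e2 e3 x1 x2 x3 x4 x5 : R) :
  f (cubic_form h d3 e1 e2 e3 x1 x2 x3 x4 x5) =
  cubic_form (f h) (f d3) (f e1) (f e2) (f e3) (f x1) (f x2) (f x3) (f x4) (f x5).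
Proof. by rewrite /cubic_form !(rmorphD, rmorphM, rmorphXn, rmorph1). Qed.

(** The curve where [x1 = x2 = 0] is the double cover [s^2 = branch t] of the
    line. *)
Definition branch (R : comNzRingType) (h d3 e1 e2 e3 t : R) : R :=
  h ^+ 2 * t ^+ 4 - d3 * t ^+ 3 - e1 * t ^+ 2 - e2 * t - e3.

Lemma rmorph_branch (R S : comNzRingType) (f : {rmorphism R -> S}) (h d3 e1 e2 e3 t : R) :
  f (branch h d3 e1 e2 e3 t) = branch (f h) (f d3) (f e1) (f e2) (f e3) (f t).
Proof. by rewrite /branch !(rmorphB, rmorphM, rmorphXn). Qed.

Section Param.
Variables (R : comNzRingType) (h t th lam n1 n2 : R).

(** Let [th^2 = branch t].  The point [(th X1, th X2, th S - h t^2, t, 1)] lies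
    on the cubic if [X1 X2 + S^2 = 1]; this quadric is parametrised by
    [X1 = 2 m1 / (1 + m1 m2)], [X2 = 2 m2 / (1 + m1 m2)] and
    [S = (1 - m1 m2) / (1 + m1 m2)], and [m1 = 1/n1 + 1/n2],
    [m2 = 1/n1 - 1/n2] make the exchange of [x1] and [x2] a change of sign
    of [n2].  The curve [x1 = x2 = 0] corresponds to large [n1] and [n2], so
    that leading monomials describe the behaviour along it.  Denominators are
    cleared, and [lam] keeps track of the degree. *)
Definition param : 'I_5 -> R :=
  let p := n1 * n2 in let d := n2 ^+ 2 - n1 ^+ 2 in
  vec5 (lam * (2 * th * p * (n1 + n2))) (lam * (2 * th * p * (n2 - n1)))
       (lam * (th * (p ^+ 2 - d) - h * t ^+ 2 * (p ^+ 2 + d)))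
       (lam * (t * (p ^+ 2 + d))) (lam * (p ^+ 2 + d)).

Lemma cubic_form_param (d3 e1 e2 e3 : R) : th ^+ 2 = branch h d3 e1 e2 e3 t ->
  cubic_form h d3 e1 e2 e3 (param (inord 0)) (param (inord 1)) (param (inord 2))
    (param (inord 3)) (param (inord 4)) = 0.
Proof.
move=> thE; rewrite /param /vec5 !inordK //=.
transitivity ((lam * ((n1 * n2) ^+ 2 + (n2 ^+ 2 - n1 ^+ 2))) ^+ 3
   * (th ^+ 2 - branch h d3 e1 e2 e3 t)).
  by rewrite /cubic_form /branch; ring.
by rewrite thE subrr mulr0.
Qed.

End Param.

Lemma rmorph_param (R S : comNzRingType) (f : {rmorphism R -> S}) (h t th lam n1 n2 : R) :
  f \o param h t th lam n1 n2 =1 param (f h) (f t) (f th) (f lam) (f n1) (f n2).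
Proof.
move=> i; rewrite /param comp_vec5.
by rewrite !(rmorphD, rmorphN, rmorphM, rmorphXn, rmorph1).
Qed.

Section Cubic.
Variable k : closedFieldType.
Hypothesis char0 : [pchar k] =i pred0.
Variables h d3 e1 e2 e3 : k.
Hypothesis hd : (h != 0) || (d3 != 0).

Local Notation x := (coordx k).

Definition cubic : {mpoly k[5]} :=
  cubic_form h%:MP d3%:MP e1%:MP e2%:MP e3%:MP (x 1) (x 2) (x 3) (x 4) (x 5).

Lemma meval_cubic (v : 'I_5 -> k) : cubic.@[v] =
  cubic_form h d3 e1 e2 e3 (v (inord 0)) (v (inord 1)) (v (inord 2)) (v (inord 3)) (v (inord 4)).
Proof. by rewrite /cubic rmorph_cubic_form /= !mevalC !mevalXU. Qed.

(** The pair [(t, th)] is a generic point of the curve [s^2 = branch t]. *)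
Lemma sqrt_branch_extension : exists (L : fieldType) (i : {rmorphism k -> L}) (t th : L),
  (forall a, t <> i a) /\
  th ^+ 2 = branch (i h) (i d3) (i e1) (i e2) (i e3) t.
Proof.
pose j : {rmorphism k -> {fraction {poly k}}} := @tofrac {poly k} \o polyC.
pose tX : {fraction {poly k}} := tofrac 'X.
pose D := branch (j h) (j d3) (j e1) (j e2) (j e3) tX.
have [|L [i [th rth]]] := @root_extension _ ('X^2 - D%:P).
  by rewrite size_XnsubC.
exists L, (i \o j), (i tX), th; split=> [a /fmorph_inj/eqP|].
  rewrite tofrac_eq => /eqP E; have := size_polyX k.
  by rewrite E; case: (size_polyC a) => ->; case: (a != 0).
rewrite /= -rmorph_branch -/D; apply/eqP; rewrite -subr_eq0.
by move: rth; rewrite rmorphB /= map_polyXn map_polyC /= /root !hornerE.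
Qed.

Section Over.
Variables (L : fieldType) (i : {rmorphism k -> L}) (t th : L).
Hypothesis t_transc : forall a, t <> i a.
Hypothesis thE : th ^+ 2 = branch (i h) (i d3) (i e1) (i e2) (i e3) t.

Lemma charL (m : nat) : (m.+1)%:R != 0 :> L.
Proof. by rewrite -(rmorph_nat i m.+1) fmorph_eq0 natrS_neq0. Qed.

Lemma theta_transc a : th <> i a.
Proof.
move=> tha; pose D := branch h%:P d3%:P e1%:P e2%:P e3%:P 'X - (a ^+ 2)%:P.
have D0 : D != 0.
  apply/eqP => /polyP D0; move: hd; have := D0 4%N; have := D0 3%N.
  rewrite /D /branch !coefB !coef0 -!rmorphXn /= !mul_polyC !coefZ !coefXn !coefX !coefC /=.
  rewrite !(mulr1, mulr0, subr0, sub0r) => /eqP; rewrite oppr_eq0 => /eqP -> /eqP.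
  by rewrite expf_eq0 /= => ->; rewrite eqxx.
have /eqP[] := root_const t_transc D0.
rewrite rmorphB rmorph_branch /= !map_polyC map_polyX hornerD hornerN.
rewrite -[X in X - _]/(horner_eval t _) rmorph_branch /= /horner_eval !hornerC hornerX.
by rewrite -thE tha rmorphXn subrr.
Qed.

(** The field [k] contains the square roots of its elements, and not [th]. *)
Lemma theta2_neq a : th ^+ 2 - i a != 0.
Proof.
have := @root_const _ _ i th ('X^2 - a%:P) theta_transc.
rewrite rmorphB /= map_polyXn map_polyC /= !hornerE; apply.
by rewrite -size_poly_gt0 size_XnsubC.
Qed.

Definition gpoint : 'I_5 -> {mpoly L[3]} :=
  param (i h)%:MP t%:MP th%:MP 'X_(inord 0) 'X_(inord 1) 'X_(inord 2).

Definition pullback : {mpoly k[5]} -> {mpoly L[3]} := mmap (@mpolyC 3 L \o i) gpoint.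
HB.instance Definition _ := GRing.RMorphism.on pullback.

Lemma pullbackXU j : pullback 'X_j = gpoint j.
Proof. exact: mmapXU. Qed.

Lemma pullbackC c : pullback c%:MP = (i c)%:MP.
Proof. by rewrite /pullback mmapC. Qed.

Lemma pullback_cubic : pullback cubic = 0.
Proof.
rewrite /cubic rmorph_cubic_form /= !pullbackC !pullbackXU.
apply: cubic_form_param; rewrite -!rmorphXn /= thE.
by rewrite rmorph_branch.
Qed.

Lemma vec3_fun (a b c : L) : exists v : 'I_3 -> L,
  [/\ v (inord 0) = a, v (inord 1) = b & v (inord 2) = c].
Proof. by exists (fun j => nth 0 [:: a; b; c] j); rewrite !inordK. Qed.

(** The parameters can be chosen such that the coordinates are rational functions
    of [t] alone, of which two are prescribed, up to the scalar [l]. *)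
Lemma param_point (l a b : k) : a != 0 -> l != 0 -> exists v : 'I_3 -> L,
  (fun j => (gpoint j).@[v]) =1
  vec5 (i l * ((th ^+ 2 - i b ^+ 2) / i a)) (i l * i a) (i l * (i b - i h * t ^+ 2))
    (i l * t) (i l).
Proof.
move=> a0 l0; set A := i a; set B := i b.
have A0 : A != 0 by rewrite fmorph_eq0.
have sp : th ^+ 2 - B ^+ 2 + A ^+ 2 != 0.
  suff -> : th ^+ 2 - B ^+ 2 + A ^+ 2 = th ^+ 2 - i (b ^+ 2 - a ^+ 2).
    exact: theta2_neq.
  by rewrite rmorphB !rmorphXn -/A -/B; ring.
have sm : th ^+ 2 - B ^+ 2 - A ^+ 2 != 0.
  suff -> : th ^+ 2 - B ^+ 2 - A ^+ 2 = th ^+ 2 - i (b ^+ 2 + a ^+ 2).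
    exact: theta2_neq.
  by rewrite rmorphD !rmorphXn -/A -/B; ring.
have th0 : th != 0 by apply/eqP => E; apply: (@theta_transc 0); rewrite rmorph0.
have thB : th + B != 0.
  by apply/eqP => /eqP; rewrite addr_eq0 => /eqP E; apply: (@theta_transc (- b)); rewrite rmorphN.
have two : 2 != 0 :> L := charL 1.
have four : 4 != 0 :> L := charL 3.
(* m1 = (th - b) / a and m2 = a / (th + b) give S = b / th, hence the inverses of
   N1 and N2 are (m1 + m2) / 2 and (m1 - m2) / 2 *)
pose N1 := 2 * A * (th + B) / (th ^+ 2 - B ^+ 2 + A ^+ 2).
pose N2 := 2 * A * (th + B) / (th ^+ 2 - B ^+ 2 - A ^+ 2).
pose lam := i l * (th + B) / (2 * th * (N1 * N2) ^+ 2).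
have [v [v0 v1 v2]] := vec3_fun lam N1 N2.
exists v => j; rewrite -[LHS]/((meval v \o gpoint) j) rmorph_param /= !mevalC !mevalXU.
rewrite v0 v1 v2 /param.
have N10 : N1 != 0 by rewrite !mulf_neq0 ?invr_eq0.
have N20 : N2 != 0 by rewrite !mulf_neq0 ?invr_eq0.
have E5 : lam * ((N1 * N2) ^+ 2 + (N2 ^+ 2 - N1 ^+ 2)) = i l.
  by rewrite /lam /N1 /N2; field; rewrite ?A0 ?thB ?th0 ?sp ?sm ?two ?four.
have E3 : lam * (th * ((N1 * N2) ^+ 2 - (N2 ^+ 2 - N1 ^+ 2))) = i l * B.
  by rewrite /lam /N1 /N2; field; rewrite ?A0 ?thB ?th0 ?sp ?sm ?two ?four.
have E1 : lam * (2 * th * (N1 * N2) * (N1 + N2)) = i l * ((th ^+ 2 - B ^+ 2) / A).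
  by rewrite /lam /N1 /N2; field; rewrite ?A0 ?thB ?th0 ?sp ?sm ?two ?four.
have E2 : lam * (2 * th * (N1 * N2) * (N2 - N1)) = i l * A.
  by rewrite /lam /N1 /N2; field; rewrite ?A0 ?thB ?th0 ?sp ?sm ?two ?four.
rewrite E1 E2 mulrBr E3 !(mulrCA lam) E5 mulrBr.
by congr (vec5 _ _ _ _ _ j); ring.
Qed.

(** Along the points found in [param_point] the polynomial [H] becomes a
    polynomial in the transcendental [t], and [t] can be replaced by any [c] in
    [k]. *)
Lemma pullback_eq0_chart H : pullback H = 0 -> forall l a b c : k, a != 0 -> l != 0 ->
  H.@[vec5 (l * ((branch h d3 e1 e2 e3 c - b ^+ 2) / a)) (l * a) (l * (b - h * c ^+ 2))
     (l * c) l] = 0.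
Proof.
move=> H0 l a b c a0 l0; have [v vE] := param_point b a0 l0.
pose w (T : {poly k}) : 'I_5 -> {poly k} :=
  vec5 (l%:P * ((branch h%:P d3%:P e1%:P e2%:P e3%:P T - b%:P ^+ 2) * (a^-1)%:P))
    (l%:P * a%:P) (l%:P * (b%:P - h%:P * T ^+ 2)) (l%:P * T) l%:P.
pose r := mmap (@polyC k) (w 'X) H.
have r0 : r = 0.
  apply/eqP/negPn/negP => /(root_const t_transc)/eqP[].
  have := congr1 (meval v) H0; rewrite meval0 /pullback rmorph_mmap => E.
  rewrite -[RHS]E -[LHS]/((horner_eval t \o map_poly i) r) /r.
  rewrite (rmorph_mmap _ _ (horner_eval t \o map_poly i)).
  apply: mmap_eq => [u|j] /=; first by rewrite mevalC map_polyC /horner_eval hornerC.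
  rewrite [RHS]vE -[LHS]/(((horner_eval t \o map_poly i) \o w 'X) j) comp_vec5 thE.
  rewrite !(rmorph_branch, rmorphXn, rmorphM, rmorphB).
  rewrite -fmorphV /= !map_polyC map_polyX /horner_eval !hornerC hornerX //.
have := congr1 (horner_eval c) r0; rewrite rmorph0 /r rmorph_mmap => <-.
apply: mmap_eq => [u|j] /=; first by rewrite /horner_eval hornerC.
rewrite -[RHS]/((horner_eval c \o w 'X) j) comp_vec5.
rewrite !(rmorph_branch, rmorphXn, rmorphM, rmorphB).
by rewrite /= /horner_eval !hornerC hornerX.
Qed.


Definition lead_monomial : 'X_{1..3} := (U_(inord 0) + U_(inord 1) *+ 2 + U_(inord 2) *+ 2)%MM.

Lemma mlead_three (n : nat) (a b c : L) (m m1 m2 : 'X_{1..n}) :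
  a != 0 -> (m1 < m)%O -> (m2 < m)%O ->
  mlead (a *: 'X_[m] + b *: 'X_[m1] + c *: 'X_[m2]) = m
  /\ mleadc (a *: 'X_[m] + b *: 'X_[m1] + c *: 'X_[m2]) = a.
Proof.
move=> a0 lt1 lt2; set p := _ + _.
have pm : p@_m = a.
  rewrite /p !mcoeffD !mcoeffZ !mcoeffX eqxx (lt_eqF lt1) (lt_eqF lt2).
  by rewrite mulr1 !mulr0 !addr0.
suff E : mlead p = m by rewrite E.
apply: mlead_unique => [|m' lt]; first by rewrite pm.
rewrite /p !mcoeffD !mcoeffZ !mcoeffX (lt_eqF lt) (lt_eqF (lt_trans lt1 lt)).
by rewrite (lt_eqF (lt_trans lt2 lt)) !mulr0 !addr0.
Qed.

Lemma mlead_gpoint_aux (a b : L) (q : {mpoly L[3]}) : a != 0 ->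
  q = 'X_(inord 0) * (a%:MP * ('X_(inord 1) * 'X_(inord 2)) ^+ 2
        + b%:MP * ('X_(inord 2) ^+ 2 - 'X_(inord 1) ^+ 2)) ->
  mlead q = lead_monomial /\ mleadc q = a.
Proof.
move=> a0 ->.
have -> : 'X_(inord 0) * (a%:MP * ('X_(inord 1) * 'X_(inord 2)) ^+ 2 +
    b%:MP * ('X_(inord 2) ^+ 2 - 'X_(inord 1) ^+ 2)) =
    a *: 'X_[lead_monomial] + b *: 'X_[U_(inord 0) + U_(inord 2) *+ 2]
    + (- b) *: 'X_[U_(inord 0) + U_(inord 1) *+ 2] :> {mpoly L[3]}.
  rewrite -!mul_mpolyC /lead_monomial !mpolyXD mpolyCN; ring.
apply: (@mlead_three 3 a b (- b) lead_monomial) => //; apply: lt_mdeg_ltmc;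
  by rewrite /lead_monomial !mdegD !mdeg1.
Qed.

Lemma mlead_gpoint4 : mlead (gpoint (inord 4)) = lead_monomial /\ mleadc (gpoint (inord 4)) = 1.
Proof.
rewrite /gpoint /param /vec5 !inordK //=; apply: (@mlead_gpoint_aux 1 1); rewrite ?oner_neq0 //.
by rewrite mpolyC1 !mul1r.
Qed.

Lemma gpoint4_neq0 : gpoint (inord 4) != 0.
Proof. by have [_ lc] := mlead_gpoint4; rewrite -mleadc_eq0 lc oner_neq0. Qed.

Lemma gpoint1_neq0 : gpoint (inord 1) != 0.
Proof.
rewrite /gpoint /param /vec5 inordK //=.
have X0 j : 'X_j != 0 :> {mpoly L[3]} by rewrite -msupp_eq0 msuppX.
have th0 : th%:MP != 0 :> {mpoly L[3]}.
  by rewrite mpolyC_eq0; apply/eqP => E; apply: (@theta_transc 0); rewrite rmorph0.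
have two : 2 != 0 :> {mpoly L[3]} by rewrite -(rmorph_nat (@mpolyC 3 L) 2) mpolyC_eq0 (charL 1).
have Xd : 'X_(inord 2) - 'X_(inord 1) != 0 :> {mpoly L[3]}.
  apply/eqP => /mpolyP /(_ U_(inord 2)%MM); rewrite mcoeffB mcoeff0 !mcoeffXU eqxx.
  by rewrite -val_eqE /= !inordK //= subr0 => /eqP; rewrite oner_eq0.
by rewrite !mulf_neq0.
Qed.


Lemma cubic_graph : exists q,
  cubic = 'X_(inord 0) * (x 2 * x 5) + q /\ erase (inord 0) q = q.
Proof.
exists (cubic_form h%:MP d3%:MP e1%:MP e2%:MP e3%:MP 0 0 (x 3) (x 4) (x 5)); split.
  by rewrite /cubic /cubic_form /coordx /=; ring.
rewrite rmorph_cubic_form /= !eraseC !rmorph0 !eraseXU.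
by rewrite -!val_eqE /= !inordK.
Qed.

Lemma erase_x2x5 : erase (inord 0) (x 2 * x 5) = x 2 * x 5.
Proof. by rewrite rmorphM /= !eraseXU -!val_eqE /= !inordK. Qed.

Lemma x2x5_neq0 : x 2 * x 5 != 0.
Proof. by rewrite mulf_neq0 // -msupp_eq0 msuppX. Qed.

Lemma erase_cubic_neq0 j : j = inord 1 \/ j = inord 4 -> erase j cubic != 0.
Proof.
move=> jE; apply/eqP => E.
have ev v : (forall l, l != inord 2 -> l != inord 3 -> v l = 0) -> cubic.@[v] = 0.
  move=> v0; have := congr1 (meval v) E; rewrite meval_subst meval0 => <-.
  apply: meval_eq => l; case: eqP => [->|_]; last by rewrite mevalXU.
  by rewrite meval0 v0 //; case: jE => ->; rewrite -val_eqE /= !inordK.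
have ev2 a b : cubic_form h d3 e1 e2 e3 0 0 a b 0 = 0.
  have := ev (vec5 0 0 a b 0); rewrite meval_cubic /vec5 !inordK //=; apply.
  move=> l; rewrite -!val_eqE /= !inordK //.
  by case: l; do 5?case.
have d30 : d3 = 0 by rewrite -(ev2 0 1) /cubic_form; ring.
have /eqP : 2 * h = 0 by rewrite -(ev2 1 1) /cubic_form d30; ring.
rewrite mulf_eq0 (negbTE (natrS_neq0 char0 1)) /= => /eqP h0.
by move: hd; rewrite h0 d30 eqxx.
Qed.

(** Where [x2] and [x5] do not vanish, the cubic is the graph of [x1] as
    a function of the other coordinates; neither [x2] nor [x5] divides its
    equation.  So the vanishing of [H] on [X] is decided on this open set. *)
Lemma pullback_eq0P H : pullback H = 0 <-> forall v, cubic.@[v] = 0 -> H.@[v] = 0.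
Proof.
have [q [cE eq]] := cubic_graph; split=> [PH|van]; last first.
  have [|N [Q E]] := vanish_on_graph char0 cE erase_x2x5 eq x2x5_neq0 (p := H).
    by move=> v Fv _; apply: van.
  have := congr1 pullback E; rewrite !rmorphM rmorphXn rmorphM /= pullback_cubic mul0r => /eqP.
  by rewrite mulf_eq0 expf_eq0 mulf_eq0 !pullbackXU (negbTE gpoint1_neq0) (negbTE gpoint4_neq0) andbF => /eqP.
have [|N [Q E]] := vanish_on_graph char0 cE erase_x2x5 eq x2x5_neq0 (p := H).
  move=> v; rewrite meval_cubic mevalM !mevalXU /= mulf_eq0 negb_or => Fv /andP [v1 v4].
  set a := v (inord 1) / v (inord 4); set c := v (inord 3) / v (inord 4).
  have := pullback_eq0_chart PH (v (inord 2) / v (inord 4) + h * c ^+ 2) c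
     (a := a) (mulf_neq0 v1 (invr_neq0 v4)) v4.
  move=> E; rewrite -[RHS]E; apply: meval_eq => j; rewrite [LHS]vec5_eta.
  congr (vec5 _ _ _ _ _ j).
  - rewrite /a /c; apply: (mulIf (mulf_neq0 v1 v4)).
    move: Fv; rewrite /cubic_form /branch; set X := v _; set Y := v _; set Z := v _.
    set T := v _; set W := v _ => Fv.
    apply/eqP; rewrite -subr_eq0 -[X in _ == X]Fv; apply/eqP.
    by field; rewrite v1 v4.
  - by rewrite /a mulrC divfK.
  - by rewrite addrK mulrC divfK.
  by rewrite /c mulrC divfK.
suff [Q' ->] : exists Q', H = cubic * Q' by move=> v cv; rewrite mevalM cv mul0r.
elim: N => [|N IH] in Q E *; first by exists Q; rewrite -E expr0 mul1r.
move: E; rewrite exprS -!mulrA => E.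
have [|Q1 E1] := cancel_var (erase_cubic_neq0 (or_introl erefl))
    (p := x 5 * ((x 2 * x 5) ^+ N * H)); first by exists Q; exact: E.
have [|Q2 E2] := cancel_var (erase_cubic_neq0 (or_intror erefl))
    (p := (x 2 * x 5) ^+ N * H); first by exists Q1; exact: E1.
exact: IH E2.
Qed.

Lemma mlead_gpoint3 : mlead (gpoint (inord 3)) = lead_monomial /\ mleadc (gpoint (inord 3)) = t.
Proof.
have t0 : t != 0 by apply/eqP => E; apply: (@t_transc 0); rewrite rmorph0.
rewrite /gpoint /param /vec5 !inordK //=; apply: (@mlead_gpoint_aux t t) => //.
by ring.
Qed.

Lemma mlead_gpoint2 : th - i h * t ^+ 2 != 0 ->
  mlead (gpoint (inord 2)) = lead_monomial /\ mleadc (gpoint (inord 2)) = th - i h * t ^+ 2.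
Proof.
move=> c0; rewrite /gpoint /param /vec5 !inordK //=.
apply: (@mlead_gpoint_aux _ (- th - i h * t ^+ 2)) => //.
rewrite !mpolyCB mpolyCN mpolyCM [(t ^+ 2)%:MP]rmorphXn /=; ring.
Qed.

End Over.
End Cubic.

(** * Torus substitutions and leading monomials *)

Section Torus.
Variables (L L' : fieldType) (phi : {rmorphism L -> L'}) (n : nat).

Definition torus (alpha : 'I_n -> L') : {mpoly L[n]} -> {mpoly L'[n]} :=
  mmap (@mpolyC n L' \o phi) (fun j => alpha j *: 'X_j).
HB.instance Definition _ alpha := GRing.RMorphism.on (torus alpha).

Lemma torusXU alpha j : torus alpha 'X_j = alpha j *: 'X_j.
Proof. exact: mmapXU. Qed.

Lemma torusC alpha c : torus alpha c%:MP = (phi c)%:MP.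
Proof. by rewrite /torus mmapC. Qed.

Lemma mcoeff_torus alpha p m :
  (torus alpha p)@_m = phi p@_m * \prod_j alpha j ^+ m j.
Proof.
have monE m' : mmap1 (fun j => alpha j *: 'X_j : {mpoly L'[n]}) m'
   = (\prod_j alpha j ^+ m' j) *: 'X_[m'].
  rewrite /mmap1 (eq_bigr (fun j => (alpha j ^+ m' j)%:MP * 'X_j ^+ m' j)).
    by rewrite big_split /= -rmorph_prod /= mul_mpolyC mpolyXE_id.
  by move=> j _; rewrite -mul_mpolyC exprMn rmorphXn.
rewrite /torus /mmap raddf_sum /=.
have [mp|mp] := boolP (m \in msupp p).
  rewrite (bigD1_seq m) ?msupp_uniq //= monE mul_mpolyC !mcoeffZ mcoeffX eqxx mulr1.
  rewrite [X in _ + X]big1 ?addr0 // => m' /negbTE mm'.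
  by rewrite monE mul_mpolyC !mcoeffZ mcoeffX mm' !mulr0.
rewrite (memN_msupp_eq0 mp) rmorph0 mul0r; apply: big1_seq => m' /= mp'.
rewrite monE mul_mpolyC !mcoeffZ mcoeffX.
by case: eqP mp' mp => [->->|]; rewrite ?mulr0.
Qed.

Section Nonzero.
Variable alpha : 'I_n -> L'.
Hypothesis alpha0 : forall j, alpha j != 0.

Let weight0 (m : 'X_{1..n}) : \prod_j alpha j ^+ m j != 0.
Proof. by apply/prodf_neq0 => j _; rewrite expf_neq0. Qed.

Lemma mlead_torus p : mlead (torus alpha p) = mlead p.
Proof.
have [->|p0] := eqVneq p 0; first by rewrite rmorph0 !mlead0.
apply: mlead_unique => [|m lt].
  by rewrite mcoeff_torus mulf_neq0 // fmorph_eq0 mleadc_eq0.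
by rewrite mcoeff_torus (mcoeff_gt_mlead lt) rmorph0 mul0r.
Qed.

Lemma mleadc_torus p :
  mleadc (torus alpha p) = phi (mleadc p) * \prod_j alpha j ^+ mlead p j.
Proof. by rewrite mlead_torus mcoeff_torus. Qed.

Lemma torus_eq0 p : (torus alpha p == 0) = (p == 0).
Proof.
by rewrite -mleadc_eq0 mleadc_torus mulf_eq0 (negbTE (weight0 _)) orbF fmorph_eq0 mleadc_eq0.
Qed.

End Nonzero.
End Torus.

Section DistinctLeads.
Variables (K : fieldType) (n : nat).

Lemma mlead_distinct_sum (T : eqType) (s : seq T) (F : T -> {mpoly K[n]}) :
  s != [::] -> uniq s -> (forall x, x \in s -> F x != 0) ->
  {in s &, injective (fun x => mlead (F x))} ->
  exists2 x, x \in s & mlead (\sum_(y <- s) F y) = mlead (F x) /\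
     mleadc (\sum_(y <- s) F y) = mleadc (F x).
Proof.
elim: s => // x s IH _ /= /andP [xs us] F0 inj.
case: s => [|x' s] in IH xs us F0 inj *.
  by exists x; rewrite ?mem_head // big_seq1.
have [| |y ys [yl yc]] := IH isT us.
- by move=> z zs; apply: F0; rewrite inE zs orbT.
- by move=> z z' zs zs'; apply: inj; rewrite inE ?zs ?zs' orbT.
rewrite big_cons; set S := \sum_(_ <- _) _ in yl yc *.
have S0 : S != 0 by rewrite -mleadc_eq0 yc mleadc_eq0 F0 // inE ys orbT.
have ne : mlead (F x) != mlead S.
  rewrite yl; apply: contraNneq xs => /(inj x y) ->; rewrite ?mem_head //.
  by rewrite inE ys orbT.
have [lt|gt|eq] := ltgtP (mlead (F x)) (mlead S); last by rewrite eq eqxx in ne.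
- exists y; first by rewrite inE ys orbT.
  by rewrite mleadDr // mcoeffD (mcoeff_gt_mlead lt) add0r.
exists x; first exact: mem_head.
by rewrite mleadDl // mcoeffD (mcoeff_gt_mlead gt) addr0.
Qed.

End DistinctLeads.

Lemma det3 (R : comNzRingType) (A : 'I_3 -> 'I_3 -> R) :
  let a i j := A (inord i) (inord j) in
  \det (\matrix_(i, j) A i j) =
  a 0 0 * (a 1 1 * a 2 2 - a 1 2 * a 2 1) - a 0 1 * (a 1 0 * a 2 2 - a 1 2 * a 2 0)
  + a 0 2 * (a 1 0 * a 2 1 - a 1 1 * a 2 0).
Proof.
move=> a; have AE i j : A i j = a i j by rewrite /a !inord_val.
rewrite (expand_det_row _ 0) !big_ord_recl big_ord0.
rewrite /cofactor !(expand_det_row _ 0) !big_ord_recl !big_ord0 /cofactor !det_mx11 !mxE.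
rewrite !AE /= /bump /= !(add0n, addn0, addn1, add1n); ring.
Qed.

(** * Leading coefficients along a rational parametrisation *)

Lemma row_combination_inj (n : nat) (B : 'I_n -> 'I_n -> nat) (m m' : 'I_n -> nat) :
  \det (\matrix_(r, s) (B r s)%:Z) != 0 ->
  (forall s, \sum_r m r * B r s = \sum_r m' r * B r s)%N -> m =1 m'.
Proof.
move=> dB E; set M := \matrix_(r, s) _ in dB.
pose u : 'rV[int]_n := \row_r ((m r)%:Z - (m' r)%:Z).
have uM : u *m M = 0.
  apply/matrixP => i s; rewrite !mxE.
  transitivity ((\sum_r m r * B r s)%N%:Z - (\sum_r m' r * B r s)%N%:Z); last first.
    by rewrite E subrr.
  rewrite !(big_morph Posz PoszD (erefl _)) -sumrB; apply: eq_bigr => r _.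
  by rewrite !mxE mulrBl !PoszM.
move=> r; have : \det M * u 0 r = 0.
  have := congr1 (fun v => (v *m \adj M) 0 r) uM.
  by rewrite -mulmxA mul_mx_adj mul0mx mul_mx_scalar !mxE.
by move/eqP; rewrite mulf_eq0 (negbTE dB) /= mxE subr_eq0 => /eqP[].
Qed.

Lemma missing_index (n : nat) (sel : 'I_n -> 'I_n.+1) : injective sel ->
  exists o, forall a, a != o -> exists r, sel r = a.
Proof.
move=> inj; have /card1P [o oP] : #|~: [set sel r | r in 'I_n]| == 1%N.
  by rewrite cardsCs setCK card_ord card_imset // card_ord subSnn.
exists o => a ao; have : a \notin ~: [set sel r | r in 'I_n].
  by rewrite oP inE.
by rewrite inE negbK => /imsetP [r _ ->]; exists r.
Qed.

Section Normalised.
Variables (k : closedFieldType) (L : fieldType) (i : {rmorphism k -> L}) (n : nat).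
Variables (c : 'I_n -> {mpoly L[n]}).
Hypothesis c_lead : forall r, mleadc (c r) = 1.
Hypothesis c_free : \det (\matrix_(r, s) (mlead (c r) s)%:Z) != 0.

Let c0 r : c r != 0.
Proof. by rewrite -mleadc_eq0 c_lead oner_neq0. Qed.

Lemma monomial_lead (m : 'X_{1..n}) :
  [/\ mmap1 c m != 0, mleadc (mmap1 c m) = 1 &
      forall s, mlead (mmap1 c m) s = (\sum_r m r * mlead (c r) s)%N].
Proof.
rewrite /mmap1; pose K (p : {mpoly L[n]}) (v : 'I_n -> nat) :=
  [/\ p != 0, mleadc p = 1 & forall s, mlead p s = v s].
suff : K (\prod_r c r ^+ m r) (fun s => \sum_r m r * mlead (c r) s)%N by [].
elim: (index_enum 'I_n) => [|r s IH].
  rewrite big_nil; split; [exact: oner_neq0|exact: mleadc1|move=> s].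
  by rewrite mlead1 mnm0E big_nil.
move: IH; rewrite big_cons /K; set p := \prod_(j <- s) _ => -[p0 pc pm].
have cr0 : c r ^+ m r != 0 by rewrite expf_neq0.
split; first by rewrite mulf_neq0.
  by rewrite mleadM // mleadcM pc mulr1 mleadX // mleadcX c_lead expr1n.
by move=> j; rewrite mleadM // mnmDE mleadX // mulmnE big_cons pm mulnC.
Qed.

(** Distinct monomials in the [c r] have distinct leading monomials, so that no
    leading terms cancel. *)
Lemma normalised_eval (p : {mpoly k[n]}) : p != 0 ->
  let q := mmap (@mpolyC n L \o i) c p in q != 0 /\ exists a, mleadc q = i a.
Proof.
move=> p0 /=.
have F0 m : m \in msupp p -> (i p@_m)%:MP * mmap1 c m != 0.
  rewrite mcoeff_msupp => pm; have [m0 _ _] := monomial_lead m.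
  by rewrite mulf_neq0 // mpolyC_eq0 fmorph_eq0.
have FE m : m \in msupp p -> mlead ((i p@_m)%:MP * mmap1 c m) = mlead (mmap1 c m) /\
    mleadc ((i p@_m)%:MP * mmap1 c m) = i p@_m.
  rewrite mcoeff_msupp => pm; have [m0 mc _] := monomial_lead m.
  by rewrite mul_mpolyC mleadZ ?fmorph_eq0 // mcoeffZ mc mulr1.
have [| | m m' sm sm' /=|m mp [ml mc]] :=
    mlead_distinct_sum (s := msupp p) _ _ F0.
- by rewrite msupp_eq0.
- exact: msupp_uniq.
- rewrite (FE m sm).1 (FE m' sm').1 => E; apply/mnmP.
  apply: (row_combination_inj c_free) => s.
  have [_ _ mE] := monomial_lead m; have [_ _ mE'] := monomial_lead m'.
  by rewrite -mE -mE' E.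
rewrite /mmap; split; last by exists p@_m; rewrite mc (FE m mp).2.
by rewrite -mleadc_eq0 mc mleadc_eq0 F0.
Qed.
End Normalised.

Section Rational.
Variables (k : closedFieldType) (L : fieldType) (i : {rmorphism k -> L}) (n : nat).

(** The factor by which [torus alpha] multiplies the coefficient of [X_m]. *)
Definition weight (K : fieldType) (alpha : 'I_n -> K) (m : 'X_{1..n}) : K :=
  \prod_j alpha j ^+ m j.

(** The [n] coordinates [b (sel r)] have independent leading monomials.
    Rescaling the variables by [alpha], which lies in an extension [K] of [L],
    gives them leading coefficient 1; then polynomials in them have leading
    coefficients in [k], and [mleadc_eval_rational] deals with the last
    coordinate. *)
Theorem rational_leads (b : 'I_n.+1 -> {mpoly L[n]}) (sel : 'I_n -> 'I_n.+1) :
  (forall r, b (sel r) != 0) ->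
  \det (\matrix_(r, s) (mlead (b (sel r)) s)%:Z) != 0 ->
  exists (K : fieldType) (phi : {rmorphism L -> K}) (alpha : 'I_n -> K) (w : K),
    (forall j, alpha j != 0) /\
    forall Q : {mpoly k[n.+1]}, let q := mmap (@mpolyC n L \o i) b Q in
      exists r : {poly k},
        phi (mleadc q) * weight alpha (mlead q) = (map_poly (phi \o i) r).[w].
Proof.
move=> b0 dB.
have sel_inj : injective sel.
  move=> r r' E; apply/eqP/negPn/negP => ne; move/negP: dB; apply; apply/eqP.
  by apply: (determinant_alternate ne) => s; rewrite !mxE E.
have [o oP] := missing_index sel_inj.
have [|K [phi [alpha [a0 aE]]]] :=
    monomial_system (mu := fun r => (mleadc (b (sel r)))^-1) dB.
  by move=> r; rewrite invr_eq0 mleadc_eq0.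
pose iota : {rmorphism k -> K} := phi \o i.
pose c r := torus phi alpha (b (sel r)).
have cl r : mleadc (c r) = 1.
  by rewrite mleadc_torus // aE -rmorphM mulfV ?rmorph1 // mleadc_eq0.
have cfree : \det (\matrix_(r, s) (mlead (c r) s)%:Z) != 0.
  rewrite (_ : \matrix_(r, s) _ = \matrix_(r, s) (mlead (b (sel r)) s)%:Z) //.
  by apply/matrixP => r s; rewrite !mxE mlead_torus.
pose beta : {rmorphism {mpoly k[n]} -> {mpoly K[n]}} := mmap (@mpolyC n K \o iota) c.
have [||w wP] := @mleadc_eval_rational k _ K n iota beta _ _ (torus phi alpha (b o)).
- by move=> p p0; have [] := normalised_eval iota cl cfree p0.
- move=> p; have [->|p0] := eqVneq p 0.
    by exists 0; rewrite !rmorph0 mcoeff0.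
  by have [_ [a aE']] := normalised_eval iota cl cfree p0; exists a.
exists K, phi, alpha, w; split=> // Q q.
pose y a : {poly {mpoly k[n]}} := if [pick r | sel r == a] is Some r then ('X_r)%:P else 'X.
pose ymap : {rmorphism {mpoly k[n.+1]} -> {poly {mpoly k[n]}}} :=
  mmap (polyC \o @mpolyC n k) y.
pose bmap : {rmorphism {mpoly k[n.+1]} -> {mpoly L[n]}} := mmap (@mpolyC n L \o i) b.
have [r rE] := wP (ymap Q); exists r; rewrite -[RHS]rE.
have -> : (map_poly beta (ymap Q)).[torus phi alpha (b o)] = torus phi alpha q.
  apply: (mpoly_rmorph_eq (f := horner_eval (torus phi alpha (b o)) \o map_poly beta \o ymap)
    (g := torus phi alpha \o bmap)) => [a|a] /=.
    by rewrite /horner_eval /ymap /bmap !mmapC /= map_polyC hornerC /= /beta mmapC torusC.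
  rewrite /horner_eval /ymap /bmap !mmapXU /y; case: pickP => [r' /eqP <-|no].
    by rewrite map_polyC hornerC /= /beta mmapXU.
  rewrite map_polyX hornerX; congr (torus _ _ (b _)); apply/esym/eqP/negPn/negP.
  by move=> /oP [r' E]; have := no r'; rewrite E eqxx.
by rewrite mleadc_torus.
Qed.

End Rational.

Section NoRationalPoint.
Variable k : closedFieldType.
Hypothesis char0 : [pchar k] =i pred0.
Variables h d3 e1 e2 e3 : k.
Hypothesis smooth : nonsing_quartic (h ^+ 2) (- d3) (- e1) (- e2) (- e3).
Variables (K : fieldType) (iota : {rmorphism k -> K}) (t th : K).
Hypothesis t_transc : forall a, t <> iota a.
Hypothesis thE : th ^+ 2 = branch (iota h) (iota d3) (iota e1) (iota e2) (iota e3) t.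

(** Otherwise [branch] would be [h^2 t^4], with a multiple root at 0. *)
Lemma theta_shift_neq0 : th - iota h * t ^+ 2 != 0.
Proof.
rewrite subr_eq0; apply/eqP => E.
pose D := d3%:P * 'X ^+ 3 + e1%:P * 'X ^+ 2 + e2%:P * 'X + e3%:P : {poly k}.
have [D0|D0] := eqVneq D 0; last first.
  have /eqP[] := root_const t_transc D0.
  rewrite /D !(rmorphD, rmorphXn, rmorphM) /= !map_polyC map_polyX.
  rewrite !(hornerD, horner_exp, hornerM, hornerC, hornerX).
  transitivity ((iota h * t ^+ 2) ^+ 2 - branch (iota h) (iota d3) (iota e1) (iota e2) (iota e3) t).
    by rewrite /branch /=; ring.
  by rewrite -E thE subrr.
have := congr1 (fun p : {poly k} => p`_0) D0; have := congr1 (fun p : {poly k} => p`_1) D0.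
rewrite /D !coefD !mul_polyC !coefZ !coefXn !coefX !coefC /=.
rewrite !(mulr0, mulr1, add0r, addr0) => e20 e30.
have [] := smooth (x := 0) (y := 1).
- by rewrite /quartic_d1 e20; ring.
- by rewrite /quartic_d2 e30 e20; ring.
by move=> _ /eqP; rewrite oner_eq0.
Qed.

(** If [t] and [th] were rational functions of [w], the curve [s^2 = branch t]
    would have a nonconstant rational parametrisation. *)
Theorem no_rational_parametrisation (w : K) (p q r : {poly k}) :
  let ev u := (map_poly iota u).[w] in
  ev q != 0 -> ev p = ev q * t -> ev r = ev q * (th - iota h * t ^+ 2) -> False.
Proof.
move=> ev q0 pE rE.
have evE u : ev u = (horner_eval w \o map_poly iota) u by [].
have evC u : ev u%:P = iota u by rewrite /ev map_polyC hornerC.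
have evM u v : ev (u * v) = ev u * ev v by rewrite !evE rmorphM.
have tw a : w <> iota a.
  move=> wE; have evw u : ev u = iota u.[a] by rewrite /ev wE horner_map.
  apply: (@t_transc (p.[a] / q.[a])).
  by rewrite fmorph_div -!evw pE mulrAC mulfV // mul1r.
(* the value of s is q^2 th *)
pose s := r * q + h%:P * p ^+ 2.
have sE : ev s = ev q ^+ 2 * th.
  have -> : ev s = ev (r * q) + ev (h%:P * p ^+ 2) by rewrite /s !evE rmorphD.
  by rewrite !evM evC rE pE; ring.
have E : quartic (h ^+ 2)%:P (- d3)%:P (- e1)%:P (- e2)%:P (- e3)%:P p q = s ^+ 2.
  apply/eqP; rewrite -subr_eq0; apply/negPn/negP => /(root_const tw)/eqP[].
  rewrite -[LHS]/(ev _).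
  have -> u v : ev (u - v) = ev u - ev v by rewrite !evE rmorphB.
  have -> : ev (s ^+ 2) = ev q ^+ 4 * th ^+ 2.
    by rewrite expr2 evM sE; ring.
  have -> : forall c4 c3 c2 c1 c0, ev (quartic c4 c3 c2 c1 c0 p q)
      = quartic (ev c4) (ev c3) (ev c2) (ev c1) (ev c0) (ev p) (ev q).
    by move=> *; rewrite !evE; exact: rmorph_quartic.
  rewrite !evC pE thE !rmorphN rmorphXn /quartic /branch; ring.
have qn0 : q != 0 by apply: contraNneq q0 => ->; rewrite /ev rmorph0 horner0.
have [c pc] := quartic_frac_const char0 smooth qn0 E.
apply: (@t_transc c); apply: (mulfI q0); rewrite -pE pc -mul_polyC.
by rewrite evM evC mulrC.
Qed.

End NoRationalPoint.

(** * Involutions acting on a rational parametrisation *)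

Lemma mmap_homog (R S : comNzRingType) (n d : nat) (f : {rmorphism R -> S})
    (c : S) (v w : 'I_n -> S) (p : {mpoly R[n]}) :
  p \is d.-homog -> (forall i, w i = c * v i) ->
  mmap f w p = c ^+ d * mmap f v p.
Proof.
move=> /dhomogP hp wE; rewrite /mmap mulr_sumr; apply: eq_big_seq => m /hp mE.
rewrite mulrCA; congr (_ * _); rewrite /mmap1 -(mE : mdeg m = d) mdegE -prodrXr -big_split /=.
by apply: eq_bigr => i _; rewrite wE exprMn.
Qed.

(** No nonzero linear form on the plane over the field of two elements is constant
    on the points [(a i, b i)], so that these take at least three values, and
    three distinct points of this plane are affinely independent.  The last
    condition is the determinant of two differences. *)
Lemma affinely_independent_parities (I : eqType) (P : pred I) (a b : I -> bool) :
  (exists i j, [&& P i, P j & a i != a j]) ->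
  (exists i j, [&& P i, P j & b i != b j]) ->
  (exists i j, [&& P i, P j & a i (+) b i != a j (+) b j]) ->
  exists i j l, [/\ P i, P j, P l &
    (a j (+) a i) && (b l (+) b i) (+) (b j (+) b i) && (a l (+) a i)].
Proof.
move=> [i [j /and3P [Pi Pj aij]]] [i' [j' /and3P [Pi' Pj' bij']]] [i2 [j2 /and3P [Pi2 Pj2 abij2]]].
exists i, j; case: (eqVneq (b i) (b j)) => bij.
  have [l Pl bl] : exists2 l, P l & b l != b i.
    by case: (eqVneq (b i') (b i)) bij' => [->|]; [exists j'; rewrite // eq_sym|exists i'].
  exists l; split=> //.
  by move: aij bl; rewrite -bij; case: (a i) (a j) (b i) (b l) (a l) => [] [] [] [] [].
have [l Pl abl] : exists2 l, P l & a l (+) b l != a i (+) b i.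
  case: (eqVneq (a i2 (+) b i2) (a i (+) b i)) abij2 => [->|]; last by exists i2.
  by exists j2; rewrite // eq_sym.
exists l; split=> //.
by move: aij bij abl; case: (a i) (a j) (b i) (b j) (b l) (a l) => [] [] [] [] [] [].
Qed.


(** The vector [X] is recovered from [b], up to a factor, by the homogeneous
    forms [g].  If [S] fixes [b] up to a factor it fixes [X] up to a factor,
    which is 1 because one entry of [X] is fixed. *)
Lemma proportional_fixed (R : comNzRingType) (A : idomainType) (m n e : nat)
    (cst : {rmorphism R -> A}) (S : {rmorphism A -> A}) (g : 'I_n -> {mpoly R[m]})
    (b : 'I_m -> A) (X : 'I_n -> A) (l : 'I_m) (o : 'I_n) :
  (forall c, S (cst c) = cst c) ->
  (forall j, g j \is e.-homog) ->
  (forall j j', mmap cst b (g j) * X j' = mmap cst b (g j') * X j) ->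
  mmap cst b (g o) != 0 -> b l != 0 -> S (b l) != 0 ->
  (forall a c, S (b a) * b c = S (b c) * b a) ->
  S (X o) = X o -> forall j, S (X j) = X j.
Proof.
move=> Scst hg cross go0 bl0 Sbl0 par So j.
have SG j' : S (mmap cst b (g j')) = mmap cst (S \o b) (g j').
  by rewrite rmorph_mmap; apply: mmap_eq => // c /=.
have scal j' : b l ^+ e * S (mmap cst b (g j')) = S (b l) ^+ e * mmap cst b (g j').
  rewrite SG -(mmap_homog _ (w := fun a => b l * S (b a)) (hg j')) //.
  by rewrite -(mmap_homog _ (w := fun a => b l * S (b a)) (hg j')) // => a; rewrite mulrC par.
apply: (mulfI go0); apply: (mulfI (expf_neq0 e Sbl0)).
rewrite mulrA -scal [in RHS]cross [RHS]mulrA -scal -!mulrA; congr (_ * _).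
by have := congr1 S (cross o j); rewrite !rmorphM So.
Qed.

Definition vec3 (R : Type) (a b c : R) (i : 'I_3) : R := nth c [:: a; b] i.

Lemma vec3_neq0 (R : nzRingType) (a b c : R) : a != 0 -> b != 0 -> c != 0 ->
  forall j, vec3 a b c j != 0.
Proof. by move=> a0 b0 c0; case; do 3?case. Qed.

(** The vectors [b] are eigenvectors up to a common factor, with eigenvalues [d]
    under [S] and [e] under [T]; the eigenvalues under the composite are the
    products. *)
Lemma compose_characters (A : idomainType) (S T : {rmorphism A -> A})
    (ba bc ea ec da dc : A) :
  T da = da -> T dc = dc -> T ba != 0 ->
  T ba * (ec * bc) = T bc * (ea * ba) -> S ba * (dc * bc) = S bc * (da * ba) ->
  T (S ba) * ((ec * dc) * bc) = T (S bc) * ((ea * da) * ba).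
Proof.
move=> Tda Tdc Tba ET ES; apply: (mulfI Tba).
transitivity (T (S ba) * dc * (T ba * (ec * bc))); first by ring.
rewrite ET; transitivity (T (S ba * (dc * bc)) * (ea * ba)).
  by rewrite !rmorphM Tdc; ring.
by rewrite ES !rmorphM Tda; ring.
Qed.

(** Subtracting rows leaves [d] times a determinant of differences, which is
    odd. *)
Lemma det_odd_neq0 (d : nat) (M : 'I_3 -> 'I_3 -> nat) :
  let p r s := odd (M (inord r) (inord s)) in
  d != 0%N -> (forall r, M r (inord 0) = d) ->
  (p 1 1 (+) p 0 1) && (p 2 2 (+) p 0 2) (+) (p 1 2 (+) p 0 2) && (p 2 1 (+) p 0 1) ->
  \det (\matrix_(r, s) (M r s)%:Z) != 0.
Proof.
move=> p d0 Md; rewrite /p (det3 (fun r s => (M r s)%:Z)) /= !Md.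
move: (M (inord 0) (inord 1)) (M (inord 1) (inord 1)) (M (inord 2) (inord 1)) => a1 c1 l1.
move: (M (inord 0) (inord 2)) (M (inord 1) (inord 2)) (M (inord 2) (inord 2)) => a2 c2 l2 oddE.
have -> : d%:Z * (c1%:Z * l2%:Z - c2%:Z * l1%:Z) - a1%:Z * (d%:Z * l2%:Z - c2%:Z * d%:Z)
    + a2%:Z * (d%:Z * l1%:Z - c1%:Z * d%:Z)
  = d%:Z * ((c1%:Z - a1%:Z) * (l2%:Z - a2%:Z) - (c2%:Z - a2%:Z) * (l1%:Z - a1%:Z)) by ring.
rewrite mulf_neq0 //; apply/eqP => /(congr1 (intr : int -> 'F_2)).
have modE (m : nat) : m%:Z%:~R = (odd m)%:R :> 'F_2.
  rewrite -[LHS]/(m%:R) -{1}(odd_double_half m) natrD -muln2 natrM.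
  by rewrite (_ : 2%:R = 0 :> 'F_2) ?mulr0 ?addr0 //; apply: val_inj.
rewrite !(rmorphB, rmorphM) /= !modE.
by move: oddE; do 6!case: (odd _).
Qed.

Section Rigidity.
Variable k : closedFieldType.
Hypothesis char0 : [pchar k] =i pred0.
Variables h d3 e1 e2 e3 : k.
Hypothesis smooth : nonsing_quartic (h ^+ 2) (- d3) (- e1) (- e2) (- e3).
Local Notation x := (coordx k).
Local Notation F := (cubic h d3 e1 e2 e3).

Lemma smooth_lead_neq0 : (h != 0) || (d3 != 0).
Proof.
rewrite -negb_and; apply/negP => /andP [/eqP h0 /eqP d30].
have [] := smooth (x := 1) (y := 0).
- by rewrite /quartic_d1 h0 d30; ring.
- by rewrite /quartic_d2 d30; ring.
by move/eqP; rewrite oner_eq0.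
Qed.

Definition flip_coord : 'I_5 -> {mpoly k[5]} := vec5 (- x 1) (- x 2) (x 3) (x 4) (x 5).
Definition swap_coord : 'I_5 -> {mpoly k[5]} := vec5 (x 2) (x 1) (x 3) (x 4) (x 5).

Lemma prod_vec3 (R : comNzRingType) (a b c : R) (m : 'X_{1..3}) :
  \prod_j vec3 a b c j ^+ m j = a ^+ m (inord 0) * b ^+ m (inord 1) * c ^+ m (inord 2).
Proof.
rewrite !big_ord_recl big_ord0 /= mulr1 mulrA /vec3 /=.
by congr (_ ^+ m _ * _ ^+ m _ * _ ^+ m _); apply: val_inj; rewrite /= inordK.
Qed.

Section Over.
Variables (L : fieldType) (i : {rmorphism k -> L}) (t th : L).
Hypothesis t_transc : forall a, t <> i a.
Hypothesis thE : th ^+ 2 = branch (i h) (i d3) (i e1) (i e2) (i e3) t.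
Local Notation pb := (pullback h i t th).
Local Notation gpoint := (gpoint h i t th).
Local Notation sc a b c := (torus (idfun : {rmorphism L -> L}) (vec3 a b c)).

Lemma sc_gpoint a b c : sc a b c \o gpoint =1
  param (i h)%:MP t%:MP th%:MP (a *: 'X_(inord 0)) (b *: 'X_(inord 1)) (c *: 'X_(inord 2)).
Proof. by move=> j; rewrite rmorph_param /= !torusC !torusXU /vec3 !inordK. Qed.

Lemma pullback_subst a b c (v : 'I_5 -> {mpoly k[5]}) (H : {mpoly k[5]}) :
  (forall j, pb (v j) = sc a b c (gpoint j)) ->
  pb (subst v H) = sc a b c (pb H).
Proof.
move=> vE; apply: (mpoly_rmorph_eq (f := pb \o subst v) (g := sc a b c \o pb)) => [u|j] /=.
  by rewrite substC !pullbackC torusC.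
by rewrite substXU pullbackXU vE.
Qed.

Lemma pullback_flip H : pb (subst flip_coord H) = sc 1 (-1) (-1) (pb H).
Proof.
apply: pullback_subst => j; rewrite -[RHS]/((sc 1 (-1) (-1) \o gpoint) j) sc_gpoint /flip_coord.
rewrite -[LHS]/((pb \o vec5 _ _ _ _ _) j) comp_vec5 !rmorphN /= !pullbackXU /= /gpoint /param.
rewrite /vec5 !inordK //= -!/(vec5 _ _ _ _ _ j).
by congr (vec5 _ _ _ _ _ j); rewrite -!mul_mpolyC !mpolyCN !mpolyC1; ring.
Qed.

Lemma pullback_swap H : pb (subst swap_coord H) = sc 1 1 (-1) (pb H).
Proof.
apply: pullback_subst => j; rewrite -[RHS]/((sc 1 1 (-1) \o gpoint) j) sc_gpoint /swap_coord.
rewrite -[LHS]/((pb \o vec5 _ _ _ _ _) j) comp_vec5 /= !pullbackXU /= /gpoint /param.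
rewrite /vec5 !inordK //= -!/(vec5 _ _ _ _ _ j).
by congr (vec5 _ _ _ _ _ j); rewrite -!mul_mpolyC !mpolyCN !mpolyC1; ring.
Qed.

(** Multiplying the first parameter by 2 exhibits the degree of [f] as the
    exponent of this parameter. *)
Lemma pullback_double (f : {mpoly k[5]}) d : f \is d.-homog ->
  sc 2 1 1 (pb f) = 2 ^+ d * pb f.
Proof.
move=> hf; rewrite /pb rmorph_mmap.
have two : (2 : L)%:MP = 2 :> {mpoly L[3]} by exact: (rmorph_nat (@mpolyC 3 L) 2).
have wE j : (sc 2 1 1 \o gpoint) j = 2 * gpoint j.
  rewrite sc_gpoint /gpoint /param -[RHS]/(( *%R 2 \o vec5 _ _ _ _ _) j) comp_vec5.
  by congr (vec5 _ _ _ _ _ j); rewrite -!mul_mpolyC !mpolyC1 two; ring.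
rewrite -(@mmap_homog _ _ _ _ (@mpolyC 3 L \o i) 2 gpoint (sc 2 1 1 \o gpoint) f hf wE).
by apply: mmap_eq => // u /=; rewrite torusC.
Qed.


Variables (d e : nat) (f : 'I_4 -> {mpoly k[5]}) (g : 'I_5 -> {mpoly k[4]}).
Hypothesis hf : forall a, f a \is d.-homog.
Hypothesis hg : forall j, g j \is e.-homog.
Variables eps del : 'I_4 -> k.
Definition comp_tuple j := mmap (@mpolyC 5 k) f (g j).
Local Notation G := comp_tuple.

(** The forms [f] define a birational map with inverse [g], and its coordinates
    are multiplied by [eps] and [del], up to a common factor, under the two
    involutions. *)
Hypothesis eps0 : forall a, eps a != 0.
Hypothesis del0 : forall a, del a != 0.

Hypothesis inverse_eq : forall v, F.@[v] = 0 -> forall l a c,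
  (f l).@[v] * ((G a).@[v] * v c - (G c).@[v] * v a) = 0.
Hypothesis inverse_def : exists v l a, F.@[v] = 0 /\ (f l).@[v] * (G a).@[v] != 0.
Hypothesis flip_eq : forall v, F.@[v] = 0 -> forall a c,
  (subst flip_coord (f a)).@[v] * (eps c * (f c).@[v]) =
  (subst flip_coord (f c)).@[v] * (eps a * (f a).@[v]).
Hypothesis swap_eq : forall v, F.@[v] = 0 -> forall a c,
  (subst swap_coord (f a)).@[v] * (del c * (f c).@[v]) =
  (subst swap_coord (f c)).@[v] * (del a * (f a).@[v]).

Let b a := pb (f a).

Let pullback_eq0 H : pb H = 0 <-> forall v, F.@[v] = 0 -> H.@[v] = 0 :=
  pullback_eq0P char0 smooth_lead_neq0 t_transc thE H.

Lemma pullback_comp j : pb (G j) = mmap (@mpolyC 3 L \o i) b (g j).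
Proof.
rewrite /G rmorph_mmap; apply: mmap_eq => // c /=.
by rewrite pullbackC.
Qed.

Lemma inverse_pullback : [/\ exists l, b l != 0, pb (G (inord 4)) != 0 &
  forall a c, pb (G a) * gpoint c = pb (G c) * gpoint a].
Proof.
have [v [l [a [Fv ne]]]] := inverse_def.
have: pb (f l * G a) != 0.
  by apply/eqP => /pullback_eq0/(_ v Fv)/eqP; rewrite mevalM (negbTE ne).
rewrite rmorphM /= mulf_eq0 negb_or => /andP [bl Ga].
have cross a' c' : pb (G a') * gpoint c' = pb (G c') * gpoint a'.
  apply: (mulfI bl); apply/eqP; rewrite -subr_eq0; apply/eqP.
  rewrite -!(pullbackXU _ _ _ _ c') -!(pullbackXU _ _ _ _ a').
  rewrite -mulrBr -!rmorphM -rmorphB -rmorphM /=.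
  apply/pullback_eq0 => u Fu; rewrite mevalM mevalB !mevalM !mevalXU.
  exact: inverse_eq.
split; [by exists l| |exact: cross].
apply/eqP => G4; have /eqP := cross a (inord 4).
by rewrite G4 mul0r mulf_eq0 (negbTE Ga) (negbTE (gpoint4_neq0 _ _ _ _)).
Qed.

(** An involution that multiplied all nonzero coordinates [b a] by the same
    eigenvalue would act trivially on the cubic, by [proportional_fixed].  On
    leading terms the eigenvalue shows as the sign by which the substitution
    acts on the leading monomial. *)
Lemma involution_separates (u0 u1 u2 : L) (cc : 'I_4 -> L) (m : 'I_5) :
  u0 != 0 -> u1 != 0 -> u2 != 0 -> (forall a, cc a != 0) ->
  (forall a c, sc u0 u1 u2 (b a) * ((cc c)%:MP * b c)
             = sc u0 u1 u2 (b c) * ((cc a)%:MP * b a)) ->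
  sc u0 u1 u2 (gpoint (inord 4)) = gpoint (inord 4) ->
  sc u0 u1 u2 (gpoint m) != gpoint m ->
  exists a c, [/\ b a != 0, b c != 0 &
    \prod_j vec3 u0 u1 u2 j ^+ mlead (b a) j != \prod_j vec3 u0 u1 u2 j ^+ mlead (b c) j].
Proof.
move=> u00 u10 u20 cc0 eqv fix4 movem.
have u0' := vec3_neq0 u00 u10 u20.
have [[l bl] G4 cross] := inverse_pullback.
have [[a [c [ba bc ne]]]|no] :=
  classic (exists a c, [/\ b a != 0, b c != 0 & cc a != cc c]).
  exists a, c; split=> //; apply: contra_neq ne => wE.
  have lc a' c' : b a' != 0 -> b c' != 0 ->
     mleadc (sc u0 u1 u2 (b a') * ((cc c')%:MP * b c')) =
     (mleadc (b a') * \prod_j vec3 u0 u1 u2 j ^+ mlead (b a') j) * (cc c' * mleadc (b c')).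
    move=> ba' bc'.
    rewrite mul_mpolyC mleadM ?scaler_eq0 ?negb_or ?cc0 ?torus_eq0 //.
    by rewrite mleadcM mleadc_torus // mleadZ // mcoeffZ.
  have E := lc a c ba bc; rewrite eqv lc // wE in E.
  set w := \prod_j _ in E.
  have w0 : w != 0 by apply/prodf_neq0 => j _; rewrite expf_neq0.
  have ma : mleadc (b a) != 0 by rewrite mleadc_eq0.
  have mc : mleadc (b c) != 0 by rewrite mleadc_eq0.
  apply: (mulfI w0); apply: (mulfI ma); apply: (mulfI mc).
  transitivity (mleadc (b c) * w * (cc a * mleadc (b a))); first by ring.
  by rewrite E; ring.
exfalso; have par a c : sc u0 u1 u2 (b a) * b c = sc u0 u1 u2 (b c) * b a.
  have [ba|ba] := eqVneq (b a) 0; first by rewrite ba rmorph0 mul0r mulr0.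
  have [bc|bc] := eqVneq (b c) 0; first by rewrite bc rmorph0 mul0r mulr0.
  have cE : cc a = cc c by apply/eqP/negPn/negP => ne; apply: no; exists a, c.
  have cM : (cc a)%:MP != 0 :> {mpoly L[3]} by rewrite mpolyC_eq0.
  apply: (mulfI cM); rewrite mulrCA [RHS]mulrCA {1}cE; exact: eqv.
move/eqP: movem; apply.
apply: (@proportional_fixed _ _ _ _ e (@mpolyC 3 L \o i) (sc u0 u1 u2) g b gpoint l (inord 4)).
- by move=> c; rewrite /= torusC.
- exact: hg.
- by move=> j j'; rewrite -!pullback_comp; exact: cross.
- by rewrite -pullback_comp.
- exact: bl.
- by rewrite torus_eq0.
- exact: par.
- exact: fix4.
Qed.


Lemma flip_pullback a c : sc 1 (-1) (-1) (b a) * ((i (eps c))%:MP * b c)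
  = sc 1 (-1) (-1) (b c) * ((i (eps a))%:MP * b a).
Proof.
rewrite -!pullback_flip -!(pullbackC h i t th) -!rmorphM; apply/eqP; rewrite -subr_eq0 -rmorphB.
apply/eqP/pullback_eq0 => v Fv; apply/eqP; rewrite mevalB !mevalM !mevalC subr_eq0.
by apply/eqP; exact: flip_eq.
Qed.

Lemma swap_pullback a c : sc 1 1 (-1) (b a) * ((i (del c))%:MP * b c)
  = sc 1 1 (-1) (b c) * ((i (del a))%:MP * b a).
Proof.
rewrite -!pullback_swap -!(pullbackC h i t th) -!rmorphM; apply/eqP; rewrite -subr_eq0 -rmorphB.
apply/eqP/pullback_eq0 => v Fv; apply/eqP; rewrite mevalB !mevalM !mevalC subr_eq0.
by apply/eqP; exact: swap_eq.
Qed.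

Lemma sc_comp u0 u1 u2 v0 v1 v2 p :
  sc u0 u1 u2 (sc v0 v1 v2 p) = sc (u0 * v0) (u1 * v1) (u2 * v2) p.
Proof.
apply/mpolyP => m; rewrite !mcoeff_torus /= -mulrA -big_split /=; congr (_ * _).
apply: eq_bigr => j _; rewrite -exprMn mulrC; congr (_ ^+ _).
by case: j; do 3?case.
Qed.

Lemma signs_neq0 : (1 : L) != 0 /\ (-1 : L) != 0.
Proof. by rewrite oppr_eq0 oner_neq0. Qed.

Lemma flip_swap_pullback a c : sc 1 (-1) 1 (b a) * ((i (eps c * del c))%:MP * b c)
  = sc 1 (-1) 1 (b c) * ((i (eps a * del a))%:MP * b a).
Proof.
have TSE p : sc 1 (-1) 1 p = sc 1 (-1) (-1) (sc 1 1 (-1) p).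
  by rewrite sc_comp !mul1r mulr1 mulrNN mulr1.
have [ba|ba] := eqVneq (b a) 0; first by rewrite ba rmorph0 mul0r !mulr0.
have [o0 m0] := signs_neq0; have u0' := vec3_neq0 o0 m0 m0.
rewrite !TSE ![i (_ * _)]rmorphM !mpolyCM.
apply: compose_characters; [exact: torusC|exact: torusC| | exact: flip_pullback|exact: swap_pullback].
by rewrite torus_eq0.
Qed.

Lemma gpoint01_neq_opp : gpoint (inord 0) - gpoint (inord 1) != 0 /\ gpoint (inord 0) + gpoint (inord 1) != 0.
Proof.
have X0 j : 'X_j != 0 :> {mpoly L[3]} by rewrite -msupp_eq0 msuppX.
have th0 : th%:MP != 0 :> {mpoly L[3]}.
  rewrite mpolyC_eq0; apply/eqP => E.
  by apply: (@theta_transc _ _ _ _ _ _ smooth_lead_neq0 _ _ _ _ t_transc thE 0); rewrite rmorph0.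
have four : 4 != 0 :> {mpoly L[3]}.
  by rewrite -(rmorph_nat (@mpolyC 3 L) 4) mpolyC_eq0 (charL char0 i 3).
rewrite /gpoint /param /vec5 !inordK //=.
set l := 'X_(inord 0); set p := 'X_(inord 1); set q := 'X_(inord 2).
split.
  suff -> : l * (2 * th%:MP * (p * q) * (p + q)) - l * (2 * th%:MP * (p * q) * (q - p))
    = 4 * (l * (th%:MP * (p * p * q))) by rewrite !mulf_neq0 ?X0.
  by ring.
suff -> : l * (2 * th%:MP * (p * q) * (p + q)) + l * (2 * th%:MP * (p * q) * (q - p))
    = 4 * (l * (th%:MP * (p * q * q))) by rewrite !mulf_neq0 ?X0.
by ring.
Qed.

Lemma sc_gpoint4 (s1 s2 : L) : s1 ^+ 2 = 1 -> s2 ^+ 2 = 1 ->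
  sc 1 s1 s2 (gpoint (inord 4)) = gpoint (inord 4).
Proof.
move=> s1E s2E; rewrite -[LHS]/((sc 1 s1 s2 \o gpoint) (inord 4)) sc_gpoint /gpoint /param.
have s1M : s1%:MP ^+ 2 = 1 :> {mpoly L[3]} by rewrite -rmorphXn /= s1E.
have s2M : s2%:MP ^+ 2 = 1 :> {mpoly L[3]} by rewrite -rmorphXn /= s2E.
rewrite /vec5 !inordK //= -!mul_mpolyC mpolyC1 mul1r.
by rewrite !exprMn s1M s2M !mul1r.
Qed.

Lemma sign_parity (m m' : nat) : (-1) ^+ m != (-1) ^+ m' :> L -> odd m != odd m'.
Proof. by rewrite -signr_odd -[X in _ != X]signr_odd; apply: contra_neq => ->. Qed.

(** The three nontrivial elements of the Klein four-group give the three linear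
    forms on pairs of parities. *)
Lemma independent_parities : let par j a := odd (mlead (b a) (inord j)) in
  exists a c l, [/\ b a != 0, b c != 0, b l != 0 &
    (par 1 c (+) par 1 a) && (par 2 l (+) par 2 a)
     (+) (par 2 c (+) par 2 a) && (par 1 l (+) par 1 a)].
Proof.
move=> par; have [o0 m0] := signs_neq0; have [ne_sub ne_add] := gpoint01_neq_opp.
have sq1 : (1 : L) ^+ 2 = 1 by rewrite expr1n.
have sqN : (-1 : L) ^+ 2 = 1 by rewrite sqrrN expr1n.
have two0 : 2 != 0 :> {mpoly L[3]}.
  by rewrite -(rmorph_nat (@mpolyC 3 L) 2) mpolyC_eq0 (charL char0 i 1).
have Th1 : gpoint (inord 1) != 0 by exact: (gpoint1_neq0 char0 smooth_lead_neq0 t_transc thE).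
have ie a : i (eps a) != 0 by rewrite fmorph_eq0.
have id a : i (del a) != 0 by rewrite fmorph_eq0.
have ied a : i (eps a * del a) != 0 by rewrite fmorph_eq0 mulf_neq0.
apply: affinely_independent_parities.
- have [|a [c [ba bc]]] := involution_separates (m := inord 1) o0 m0 o0 ied flip_swap_pullback
    (sc_gpoint4 sqN sq1).
    rewrite -[X in X != _]/((sc 1 (-1) 1 \o gpoint) (inord 1)) sc_gpoint.
    apply: contra_neq ne_add => E; rewrite -E /gpoint /param /vec5 !inordK //=.
    by rewrite -!mul_mpolyC !mpolyC1 mpolyCN mpolyC1; ring.
  rewrite !prod_vec3 !expr1n !mul1r !mulr1 => /sign_parity ne.
  by exists a, c; rewrite ba bc.
- have [|a [c [ba bc]]] := involution_separates (m := inord 1) o0 o0 m0 id swap_pullback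
    (sc_gpoint4 sq1 sqN).
    rewrite -[X in X != _]/((sc 1 1 (-1) \o gpoint) (inord 1)) sc_gpoint.
    apply: contra_neq ne_sub => E; rewrite -E /gpoint /param /vec5 !inordK //=.
    by rewrite -!mul_mpolyC !mpolyC1 mpolyCN mpolyC1; ring.
  rewrite !prod_vec3 !expr1n !mul1r => /sign_parity ne.
  by exists a, c; rewrite ba bc.
have [|a [c [ba bc]]] := involution_separates (m := inord 1) o0 m0 m0 ie flip_pullback
    (sc_gpoint4 sqN sqN).
  rewrite -[X in X != _]/((sc 1 (-1) (-1) \o gpoint) (inord 1)) sc_gpoint.
  apply: contra_neq Th1 => E; apply: (mulfI two0); rewrite mulr0.
  rewrite mulr_natl mulr2n -{1}E /gpoint /param /vec5 !inordK //=.
  by rewrite -!mul_mpolyC !mpolyC1 mpolyCN mpolyC1; ring.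
rewrite !prod_vec3 !expr1n !mul1r -!exprD => /sign_parity; rewrite !oddD => ne.
by exists a, c; rewrite ba bc.
Qed.

Lemma mlead_degree a : b a != 0 -> mlead (b a) (inord 0) = d.
Proof.
move=> ba; have := congr1 (mcoeff (mlead (b a))) (pullback_double (hf a)).
rewrite mcoeff_torus prod_vec3 !expr1n !mulr1.
have -> : 2 ^+ d = ((2 ^ d)%N%:R : L)%:MP :> {mpoly L[3]}.
  by rewrite (rmorph_nat (@mpolyC 3 L)) natrX.
rewrite mcoeffCM mulrC => E; have ma : mleadc (b a) != 0 by rewrite mleadc_eq0.
have {}E := mulIf ma E; rewrite -natrX in E.
by have /eqP := natr_injective (charL char0 i) E; rewrite eqn_exp2l // => /eqP.
Qed.

(** Otherwise the map would be constant, and no involution could separate its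
    coordinates. *)
Lemma degree_neq0 : d != 0%N.
Proof.
apply/eqP => d0.
have bC a : b a = (mmap i (fun=> 0) (f a))%:MP.
  rewrite /b /pullback -[RHS]/((@mpolyC 3 L) (mmap i (fun=> 0) (f a))) rmorph_mmap.
  have := @mmap_homog _ _ _ _ (@mpolyC 3 L \o i) 0 gpoint (fun=> 0) (f a) (hf a).
  rewrite d0 expr0 mul1r => <- => [|j]; last by rewrite mul0r.
  by apply: mmap_eq => // j /=; rewrite mpolyC0.
have [a [c [l [_ _ _]]]] := independent_parities.
by rewrite /= !bC !mleadC !mnm0E.
Qed.

Lemma independent_leads : exists sel : 'I_3 -> 'I_4,
  (forall r, b (sel r) != 0) /\
  \det (\matrix_(r, s) (mlead (b (sel r)) s)%:Z) != 0.
Proof.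
have [a [c [l [ba bc bl par]]]] := independent_parities.
have b0 : forall r, b (vec3 a c l r) != 0.
  by case=> [[|[|[|r]]] lt]; [exact: ba|exact: bc|exact: bl|].
exists (vec3 a c l); split; first exact: b0.
apply: (det_odd_neq0 degree_neq0) => [r|]; first by rewrite mlead_degree.
by rewrite /vec3 !inordK.
Qed.

(** Comparing leading coefficients in [g_4(b) * x_j = g_j(b) * x_4], with
    coordinates numbered from 0, shows that [t] and [th] are rational functions
    of the element [w] of [rational_leads]. *)
Lemma no_klein_map_over : False.
Proof.
have [sel [b0 dB]] := independent_leads.
have [K [phi [alpha [w [a0 wP]]]]] := @rational_leads k L i 3 b sel b0 dB.
have [_ G4 cross] := inverse_pullback; rewrite pullback_comp in G4.
have T4 := mlead_gpoint4 h i t th; have T3 := mlead_gpoint3 h th t_transc.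
have c0 := theta_shift_neq0 smooth t_transc thE.
have T2 := mlead_gpoint2 c0.
pose q j := mmap (@mpolyC 3 L \o i) b (g j).
pose val j := phi (mleadc (q j)) * weight alpha (mlead (q j)).
have rel j c : c != 0 -> mlead (gpoint j) = lead_monomial /\ mleadc (gpoint j) = c ->
    val j = val (inord 4) * phi c.
  move=> cn [ml mc]; have := cross (inord 4) j; rewrite !pullback_comp -/(q _) -/(q _) => E.
  have Tj : gpoint j != 0 by rewrite -mleadc_eq0 mc.
  have T40 : gpoint (inord 4) != 0 by rewrite -mleadc_eq0 T4.2 oner_neq0.
  have qj : q j != 0.
    apply/eqP => qj0; move/eqP: E; rewrite qj0 mul0r mulf_eq0.
    by rewrite (negbTE G4) (negbTE Tj).
  have := congr1 (fun p => mlead p) E; rewrite !mleadM // ml T4.1 => /addIm E1.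
  have := congr1 (mcoeff (mlead (q j) + lead_monomial)%MM) E.
  rewrite -{1}E1 -{1}ml -{1}T4.1 !mleadcM mc T4.2 mulr1 => E2.
  by rewrite /val -E2 E1 rmorphM mulrAC.
have [r4 r4E] := wP (g (inord 4)); have [r3 r3E] := wP (g (inord 3)).
have [r2 r2E] := wP (g (inord 2)).
have t0 : t != 0 by apply/eqP => E; apply: (@t_transc 0); rewrite rmorph0.
apply: (@no_rational_parametrisation k char0 h d3 e1 e2 e3 smooth K (phi \o i)
   (phi t) (phi th) _ _ w r3 r4 r2).
- by move=> a /= /fmorph_inj /t_transc.
- by rewrite -rmorphXn thE rmorph_branch.
- rewrite -r4E mulf_neq0 ?fmorph_eq0 ?mleadc_eq0 //.
  by apply/prodf_neq0 => j _; rewrite expf_neq0.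
- by rewrite -r3E -r4E; exact: rel t0 T3.
rewrite -r2E -r4E /= -rmorphXn -rmorphM -rmorphB; exact: rel c0 T2.
Qed.

End Over.

Theorem no_diagonal_klein_map (d e : nat) (f : 'I_4 -> {mpoly k[5]})
    (g : 'I_5 -> {mpoly k[4]}) (eps del : 'I_4 -> k) :
  (forall a, f a \is d.-homog) -> (forall j, g j \is e.-homog) ->
  (forall a, eps a != 0) -> (forall a, del a != 0) ->
  (forall v, F.@[v] = 0 -> forall l a c,
    (f l).@[v] * ((comp_tuple f g a).@[v] * v c - (comp_tuple f g c).@[v] * v a) = 0) ->
  (exists v l a, F.@[v] = 0 /\ (f l).@[v] * (comp_tuple f g a).@[v] != 0) ->
  (forall v, F.@[v] = 0 -> forall a c,
    (subst flip_coord (f a)).@[v] * (eps c * (f c).@[v]) =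
    (subst flip_coord (f c)).@[v] * (eps a * (f a).@[v])) ->
  (forall v, F.@[v] = 0 -> forall a c,
    (subst swap_coord (f a)).@[v] * (del c * (f c).@[v]) =
    (subst swap_coord (f c)).@[v] * (del a * (f a).@[v])) ->
  False.
Proof.
move=> hf hg eps0 del0 H1 H2 H3 H4.
have [L [i [t [th [tt thE]]]]] := sqrt_branch_extension h d3 e1 e2 e3.
exact: (no_klein_map_over tt thE hf hg eps0 del0 H1 H2 H3 H4).
Qed.

End Rigidity.

(** * From projective varieties to polynomial identities *)

Section Points.
Variables (k : fieldType) (n : nat).
Implicit Types (p q : proj k n) (u v : 'I_n.+1 -> k).

Definition line v : {vspace 'cV[k]_n.+1} := <[\col_i v i]>%VS.

Lemma line_scale (c : k) u v : c != 0 -> (forall i, u i = c * v i) -> line u = line v.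
Proof.
move=> c0 uE; have -> : line u = <[c *: \col_i v i]>%VS.
  by congr <[_]>%VS; apply/colP => i; rewrite !mxE uE.
apply/eqP; rewrite eqEsubv -!memvE; apply/andP; split.
  by rewrite memvZ ?memv_line.
by apply/vlineP; exists c^-1; rewrite scalerA mulVf ?scale1r.
Qed.

Lemma line_dim v : (\dim (line v) == 1%N) = ((\col_i v i : 'cV[k]_n.+1) != 0).
Proof. by rewrite dim_vline; case: (_ != 0). Qed.

Lemma line_eq u v : line u = line v -> exists c, forall i, u i = c * v i.
Proof.
move=> E; have : \col_i u i \in line v by rewrite -E memv_line.
by move/vlineP => [c /colP uE]; exists c => i; have := uE i; rewrite !mxE.
Qed.

Lemma line_parallel u v : line u = line v -> forall a c, u a * v c = u c * v a.
Proof. by move/line_eq => [c uE] a b; rewrite !uE; ring. Qed.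

Lemma proj_hcoord p : val p = line (hcoord p).
Proof.
have cE : \col_i hcoord p i = vpick (val p) by apply/colP => i; rewrite mxE.
apply/eqP; rewrite eq_sym eqEdim /line cE -memvE memv_pick /=.
by rewrite (eqP (valP p)) dim_vline vpick0 -dimv_eq0 (eqP (valP p)).
Qed.

Lemma proj_at v i : v i != 0 -> exists p, val p = line v.
Proof.
move=> vi; have d1 : \dim (line v) == 1%N.
  rewrite line_dim; apply: contraNneq vi => /colP/(_ i).
  by rewrite !mxE => ->.
by exists (exist _ (line v) d1).
Qed.

Lemma proj_at_neq0 p v : val p = line v -> exists i, v i != 0.
Proof.
move=> pE; have := valP p; rewrite /= pE line_dim => v0.
apply/existsP; rewrite -negb_forall; apply: contra v0 => /forallP vz.
by apply/eqP/colP => i; rewrite !mxE; apply/eqP.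
Qed.

Lemma hcoord_at p v : val p = line v ->
  exists2 c : k, c != 0 & forall i, hcoord p i = c * v i.
Proof.
move=> pE; have : line (hcoord p) = line v by rewrite -proj_hcoord.
move/line_eq => [c cE]; exists c => //.
have [i hi] := proj_at_neq0 (proj_hcoord p).
by apply: contraNneq hi => c0; rewrite cE c0 mul0r.
Qed.

Lemma pact_at (A : 'M[k]_n.+1) p v : A \in unitmx -> val p = line v ->
  val (pact A p) = line (fun i => \sum_j A i j * v j).
Proof.
move=> uA pE; rewrite val_pact // pE limg_line lfunE /=; congr <[_]>%VS.
by apply/colP => i; rewrite !mxE; apply: eq_bigr => j _; rewrite mxE.
Qed.

End Points.

Lemma meval_homog (k : fieldType) (n d : nat) (p : {mpoly k[n]}) (c : k) (u v : 'I_n -> k) :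
  p \is d.-homog -> (forall i, u i = c * v i) -> p.@[u] = c ^+ d * p.@[v].
Proof. exact: (@mmap_homog k k n d idfun c v u p). Qed.

(** Forms of the same degree map a line to the same line whatever representative
    is chosen. *)
Lemma maps_to_at (k : fieldType) (m n d : nat) (f : 'I_n.+1 -> {mpoly k[m.+1]})
    (p : proj k m) (q : proj k n) (v : 'I_m.+1 -> k) :
  (forall i, f i \is d.-homog) -> val p = line v ->
  maps_to f p q <-> val q = line (fun i => (f i).@[v]).
Proof.
move=> hf pE; have [c c0 cE] := hcoord_at pE.
rewrite /maps_to -/(line _) (line_scale (c := c ^+ d) (v := fun i => (f i).@[v])) //.
  by rewrite expf_neq0.
by move=> i; exact: meval_homog.
Qed.

Lemma involution_diagonalizable (k : fieldType) (n : nat) (A : 'M[k]_n.+1) :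
  2 != 0 :> k -> A *m A = 1%:M -> diagonalizable A.
Proof.
move=> two AA; apply/diagonalizableP; exists [:: 1; -1].
  by rewrite /= andbT inE -subr_eq0 opprK.
apply: mxminpoly_min; rewrite !big_cons big_nil mulr1.
rewrite rmorphM !rmorphB /= horner_mx_X !horner_mx_C.
have -> : (-1)%:M = -1 :> 'M[k]_n.+1 by rewrite rmorphN.
by rewrite opprK -subr_sqr_1 expr2 [A * A]AA subrr.
Qed.

(** Commuting involutions are simultaneously diagonalisable. *)
Lemma klein_representation_diag (k : fieldType) (T : Type) (n : nat)
    (G : (T -> T) -> Prop) (rho : (T -> T) -> 'M[k]_n.+1) (a b : T -> T) :
  2 != 0 :> k -> representation G rho -> G id -> G a -> G b ->
  a \o a = id -> b \o b = id -> a \o b = b \o a ->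
  exists (P : 'M[k]_n.+1) (eps del : 'I_n.+1 -> k), [/\ P \in unitmx,
    forall i, eps i != 0, forall i, del i != 0,
    forall i j, (P *m rho a) i j = eps i * P i j &
    forall i j, (P *m rho b) i j = del i * P i j].
Proof.
move=> two [rho_unit rhoM] Gid Ga Gb aa bb ab.
have rho1 : rho id = 1%:M.
  have E : rho id *m rho id = rho id by rewrite -rhoM.
  by apply: (can_inj (mulKmx (rho_unit _ Gid))); rewrite E mulmx1.
have AA : rho a *m rho a = 1%:M by rewrite -rhoM // aa.
have BB : rho b *m rho b = 1%:M by rewrite -rhoM // bb.
have AB : rho a *m rho b = rho b *m rho a by rewrite -!rhoM // ab.
have [P uP /= /and3P [dA dB _]] : exists2 P : 'M[k]_n.+1, P \in unitmx &
    all [pred A | similar_diag P A] [:: rho a; rho b].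
  apply/codiagonalizableP; split.
    by move=> A B; rewrite !inE /comm_mx => /orP [] /eqP -> /orP [] /eqP -> //; rewrite AB.
  by move=> A; rewrite !inE => /orP [] /eqP ->; apply: involution_diagonalizable.
have eig (A : 'M[k]_n.+1) : A *m A = 1%:M -> similar_diag P A ->
    exists eps : 'I_n.+1 -> k, (forall i, eps i != 0) /\
      forall i j, (P *m A) i j = eps i * P i j.
  move=> A2 /similar_diagPex [D] /(similarPp (stablemx_unit _ uP)) E.
  have PAE u j : (P *m A) u j = D 0 u * P u j by rewrite E mul_diag_mx mxE.
  exists (fun u => D 0 u); split=> // u; apply/eqP => Du.
  have uPA : P *m A \in unitmx.
    by rewrite unitmx_mul uP; case/mulmx1_unit: A2.
  have r0 : row u (P *m A) = 0 by apply/rowP => j; rewrite mxE PAE Du mul0r mxE.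
  have : (delta_mx 0 u : 'rV_n.+1) *m (P *m A) *m invmx (P *m A) = 0 by rewrite -rowE r0 mul0mx.
  by rewrite mulmxK // => /rowP/(_ u)/eqP; rewrite !mxE !eqxx oner_eq0.
have [eps [eps0 epsE]] := eig _ AA dA; have [del [del0 delE]] := eig _ BB dB.
by exists P, eps, del; split.
Qed.

Section Translate.
Variable k : closedFieldType.
Hypothesis char0 : [pchar k] =i pred0.
Variables h d3 e1 e2 e3 : k.
Local Notation F := (cubic h d3 e1 e2 e3).
Local Notation X := (hypersurface F).

Lemma cubic_scale (c : k) (u v : 'I_5 -> k) : (forall i, u i = c * v i) ->
  F.@[u] = c ^+ 3 * F.@[v].
Proof. by move=> uE; rewrite !meval_cubic !uE /cubic_form; ring. Qed.

Lemma hypersurface_at (p : proj k 4) v : val p = line v -> X p = (F.@[v] == 0).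
Proof.
move=> pE; have [c c0 cE] := hcoord_at pE.
by rewrite /hypersurface (cubic_scale cE) mulf_eq0 expf_eq0 (negbTE c0).
Qed.

Lemma point_at v i : v i != 0 -> F.@[v] = 0 -> exists p : points X, val (val p) = line v.
Proof.
move=> vi Fv; have [p pE] := proj_at vi.
have Xp : X p by rewrite (hypersurface_at pE) Fv.
by exists (exist _ p Xp).
Qed.

Definition flip (v : 'I_5 -> k) : 'I_5 -> k :=
  vec5 (- v (inord 0)) (- v (inord 1)) (v (inord 2)) (v (inord 3)) (v (inord 4)).
Definition swap (v : 'I_5 -> k) : 'I_5 -> k :=
  vec5 (v (inord 1)) (v (inord 0)) (v (inord 2)) (v (inord 3)) (v (inord 4)).

Lemma meval_flip p v : (subst (flip_coord k) p).@[v] = p.@[flip v].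
Proof.
rewrite meval_subst; apply: meval_eq => j.
rewrite -[LHS]/((meval v \o flip_coord k) j) comp_vec5.
by rewrite !rmorphN /= !mevalXU.
Qed.

Lemma meval_swap p v : (subst (swap_coord k) p).@[v] = p.@[swap v].
Proof.
rewrite meval_subst; apply: meval_eq => j.
by rewrite -[LHS]/((meval v \o swap_coord k) j) comp_vec5 /= !mevalXU.
Qed.

Definition preserves (A : 'M[k]_5) := A \in unitmx /\
  forall v, F.@[fun i => \sum_j A i j * v j] = F.@[v].

Lemma preserves_pact A : preserves A -> forall q, X q -> X (pact A q).
Proof.
move=> [uA FA] q; rewrite (hypersurface_at (proj_hcoord q)) => Xq.
by rewrite (hypersurface_at (pact_at uA (proj_hcoord q))) FA.
Qed.

Lemma restr_at A (p : points X) v : preserves A -> val (val p) = line v ->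
  val (val (restr A p)) = line (fun i => \sum_j A i j * v j).
Proof.
by move=> pA pE; rewrite val_restr; [apply: pact_at => //; case: pA|exact: preserves_pact].
Qed.

Lemma point_eq (p q : points X) : val (val p) = val (val q) -> p = q.
Proof. by move=> E; apply/val_inj/val_inj. Qed.

Lemma restr_mul A B : preserves A -> preserves B ->
  preserves (A *m B) /\ restr (Z := X) (A *m B) = restr A \o restr B.
Proof.
move=> pA pB.
have mulE v i : \sum_j (A *m B) i j * v j = \sum_j A i j * (\sum_l B j l * v l).
  under eq_bigr => j _ do rewrite mxE mulr_suml.
  rewrite exchange_big /=; apply: eq_bigr => j _; rewrite mulr_sumr.
  by apply: eq_bigr => l _; rewrite mulrA.
have pAB : preserves (A *m B).
  case: pA pB => uA FA [uB FB]; split; first by rewrite unitmx_mul uA uB.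
  by move=> v; rewrite -(FB v) -(FA (fun i => \sum_l B i l * v l)); apply: meval_eq => i.
split=> //; apply: functional_extensionality => p /=; apply: point_eq.
rewrite (restr_at pAB (proj_hcoord _)) (restr_at pA (restr_at pB (proj_hcoord _))).
by apply: (line_scale (oner_neq0 k)) => i; rewrite mul1r mulE.
Qed.

Lemma preserves1 : preserves 1%:M /\ restr (Z := X) 1%:M = id.
Proof.
have oneE v i : \sum_j (1%:M : 'M[k]_5) i j * v j = v i.
  rewrite (bigD1 i) //= mxE eqxx mul1r big1 ?addr0 // => j /negbTE ji.
  by rewrite mxE eq_sym ji mul0r.
have p1 : preserves 1%:M.
  by split=> [|v]; [exact: unitmx1|apply: meval_eq => i].
split=> //; apply: functional_extensionality => p; apply: point_eq.
rewrite (restr_at p1 (proj_hcoord _)) [RHS]proj_hcoord.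
by apply: (line_scale (oner_neq0 k)) => i; rewrite mul1r oneE.
Qed.

Lemma tau_mxE (z : k) v : (fun i => \sum_j tau_mx z i j * v j) =1
  vec5 (z * v (inord 0)) (z^-1 * v (inord 1)) (v (inord 2)) (v (inord 3)) (v (inord 4)).
Proof.
move=> i; rewrite (bigD1 i) //= big1 ?addr0 => [|j /negbTE ji].
  rewrite /tau_mx !mxE eqxx mulr1n; rewrite [v i]vec5_eta.
  by case: i; do 5?case; move=> //= lt; rewrite /vec5 /= ?nth_nil ?mul1r.
by rewrite /tau_mx mxE eq_sym ji mulr0n mul0r.
Qed.

Lemma sigma_mxE v : (fun i => \sum_j sigma_mx k i j * v j) =1 swap v.
Proof.
move=> i; transitivity (v (tperm (inord 0) (inord 1) i)).
  rewrite (bigD1 (tperm (inord 0) (inord 1) i)) //= big1 ?addr0 => [|j /negbTE ji].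
    by rewrite /sigma_mx /tperm_mx !mxE eqxx mul1r.
  by rewrite /sigma_mx /tperm_mx !mxE eq_sym ji mul0r.
rewrite /swap; case: tpermP => [->|->|].
- by rewrite /vec5 inordK.
- by rewrite /vec5 inordK.
move=> /eqP i0 /eqP i1; rewrite [LHS]vec5_eta /vec5.
by case: i i0 i1; do 5?case; move=> // lt; rewrite -!val_eqE /= !inordK.
Qed.

Lemma preserves_tau z : z != 0 -> preserves (tau_mx z).
Proof.
move=> z0; split; last first.
  move=> v; rewrite (meval_eq _ (tau_mxE z v)) !meval_cubic /vec5 !inordK //=.
  by rewrite /cubic_form; field.
rewrite unitmxE det_diag unitfE; apply/prodf_neq0 => i _; rewrite mxE.
by case: i; do 5?case; move=> //= lt; rewrite ?invr_eq0 ?nth_nil ?oner_neq0.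
Qed.

Lemma preserves_sigma : preserves (sigma_mx k).
Proof.
split; first exact: unitmx_perm.
move=> v; rewrite (meval_eq _ (sigma_mxE v)) !meval_cubic /swap /vec5 !inordK //=.
by rewrite /cubic_form; ring.
Qed.

Lemma tau_mxM (z z' : k) : tau_mx z *m tau_mx z' = tau_mx (z * z').
Proof.
rewrite /tau_mx mulmx_diag; congr diag_mx; apply/rowP => i; rewrite !mxE.
by case: i; do 5?case; move=> //= lt; rewrite ?invfM ?nth_nil ?mulr1.
Qed.

Lemma tau_mx1 : tau_mx 1 = 1%:M :> 'M[k]_5.
Proof.
rewrite /tau_mx -diag_const_mx; congr diag_mx; apply/rowP => i; rewrite !mxE.
by case: i; do 5?case; move=> //= lt; rewrite ?invr1 ?nth_nil.
Qed.

Lemma sigma_mx2 : sigma_mx k *m sigma_mx k = 1%:M.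
Proof. by rewrite /sigma_mx /tperm_mx -perm_mxM tperm2 perm_mx1. Qed.

Local Notation tauX z := (restr (Z := X) (tau_mx z)).
Local Notation sigmaX := (restr (Z := X) (sigma_mx k)).

Lemma flip_swap_comm : tauX (-1) \o sigmaX = sigmaX \o tauX (-1).
Proof.
have pt : preserves (tau_mx (-1)) by apply: preserves_tau; rewrite oppr_eq0 oner_neq0.
apply: functional_extensionality => p; apply: point_eq.
have E1 := restr_at pt (restr_at preserves_sigma (proj_hcoord (val p))).
have E2 := restr_at preserves_sigma (restr_at pt (proj_hcoord (val p))).
apply: (etrans E1); apply: etrans (esym E2).
apply: (line_scale (oner_neq0 k)) => i; rewrite mul1r [LHS]tau_mxE [RHS]sigma_mxE /swap.
by rewrite !tau_mxE !sigma_mxE /swap /vec5 !inordK //= invrN invr1.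
Qed.


Definition mix (P : 'M[k]_4) (f : 'I_4 -> {mpoly k[5]}) a := \sum_c P a c *: f c.

Lemma meval_mix P f a v : (mix P f a).@[v] = \sum_c P a c * (f c).@[v].
Proof. by rewrite /mix raddf_sum; apply: eq_bigr => c _ /=; rewrite mevalZ. Qed.

Definition unmix (P : 'M[k]_4) (g : 'I_5 -> {mpoly k[4]}) j :=
  mmap (@mpolyC 4 k) (fun c => \sum_a invmx P c a *: 'X_a : {mpoly k[4]}) (g j).

Lemma comp_unmix P f g j : P \in unitmx ->
  comp_tuple (mix P f) (unmix P g) j = comp_tuple f g j.
Proof.
move=> uP; rewrite /comp_tuple /unmix rmorph_mmap; apply: mmap_eq => [c|c] /=.
  by rewrite mmapC.
rewrite raddf_sum /=.
under eq_bigr => a _ do rewrite mmapZ mmapXU /= mul_mpolyC /mix scaler_sumr.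
rewrite exchange_big /= (bigD1 c) //= [X in _ + X]big1 ?addr0 => [|c' ne].
all: under eq_bigr => a _ do rewrite scalerA.
all: rewrite -scaler_suml.
  have := mulVmx uP => /matrixP/(_ c c); rewrite !mxE eqxx => ->.
  by rewrite scale1r.
have := mulVmx uP => /matrixP/(_ c c'); rewrite !mxE eq_sym (negbTE ne) => ->.
by rewrite scale0r.
Qed.

Lemma mix_homog P f d a : (forall c, f c \is d.-homog) -> mix P f a \is d.-homog.
Proof. by move=> hf; apply: rpred_sum => c _; apply: rpredZ. Qed.

Lemma unmix_homog P g e j : g j \is e.-homog -> unmix P g j \is e.-homog.
Proof.
move=> /dhomogP hg; rewrite /unmix; set lin := (fun c : 'I_4 => _).
have hl c : lin c \is 1.-homog.
  by apply: rpred_sum => a _; apply: rpredZ; rewrite dhomogX /= mdeg1.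
rewrite /mmap big_seq; apply: rpred_sum => m /hg mE; clearbody lin.
rewrite mul_mpolyC; apply: rpredZ; rewrite -(mE : mdeg m = e) mdegE /mmap1.
elim: (index_enum _) => [|c s IH]; first by rewrite !big_nil dhomog1.
rewrite !big_cons; apply: dhomogM => //.
by have := dhomogMn (m c) (hl c); rewrite mul1n.
Qed.

Lemma equivariant_at (G : (points X -> points X) -> Prop)
    (rho : (points X -> points X) -> 'M[k]_4) (f : 'I_4 -> {mpoly k[5]}) d
    (A : 'M[k]_5) (v w : 'I_5 -> k) i :
  representation G rho -> equivariant G rho f -> (forall a, f a \is d.-homog) ->
  preserves A -> G (restr (Z := X) A) -> F.@[v] = 0 -> v i != 0 ->
  (fun i => \sum_j A i j * v j) =1 w ->
  forall a c, (f a).@[w] * (\sum_b rho (restr (Z := X) A) c b * (f b).@[v]) =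
     (f c).@[w] * (\sum_b rho (restr (Z := X) A) a b * (f b).@[v]).
Proof.
move=> [rho_unit _] eqv hf pA GA Fv vi wE.
have [p pE] := point_at vi Fv.
have pE' : val (val (restr A p)) = line w.
  rewrite (restr_at pA pE); apply: (line_scale (oner_neq0 k)) => j.
  by rewrite mul1r wE.
have [[a0 fa0]|no] := classic (exists a, (f a).@[v] != 0); last first.
  have f0 b : (f b).@[v] = 0 by apply/eqP/negPn/negP => ne; apply: no; exists b.
  by move=> a c; rewrite !big1 ?mulr0 // => b _; rewrite f0 mulr0.
have [[b0 fb0]|no] := classic (exists a, (f a).@[w] != 0); last first.
  have f0 b : (f b).@[w] = 0 by apply/eqP/negPn/negP => ne; apply: no; exists b.
  by move=> a c; rewrite !f0 !mul0r.
have [q qE] := proj_at (v := fun a => (f a).@[v]) fa0.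
have [r rE] := proj_at (v := fun a => (f a).@[w]) fb0.
have /= E := eqv _ GA p q r ((maps_to_at q hf pE).2 qE) ((maps_to_at r hf pE').2 rE).
have := pact_at (rho_unit _ GA) qE; rewrite -E rE => /line_parallel par a c.
exact: par.
Qed.

(** At [v = 0] the forms vanish unless their degree is 0; then they are constant,
    and the relation holds because it does at another point. *)
Lemma equivariant_at0 (G : (points X -> points X) -> Prop)
    (rho : (points X -> points X) -> 'M[k]_4) (f : 'I_4 -> {mpoly k[5]}) d
    (A : 'M[k]_5) (v w : 'I_5 -> k) :
  representation G rho -> equivariant G rho f -> (forall a, f a \is d.-homog) ->
  preserves A -> G (restr (Z := X) A) -> F.@[v] = 0 ->
  (fun i => \sum_j A i j * v j) =1 w ->
  forall a c, (f a).@[w] * (\sum_b rho (restr (Z := X) A) c b * (f b).@[v]) =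
     (f c).@[w] * (\sum_b rho (restr (Z := X) A) a b * (f b).@[v]).
Proof.
move=> repr eqv hf pA GA Fv wE.
have [[i vi]|no] := classic (exists i, v i != 0).
  exact: equivariant_at repr eqv hf pA GA Fv vi wE.
have v0 i : v i = 0 by apply/eqP/negPn/negP => ne; apply: no; exists i.
have scal0 b u : (f b).@[v] = 0 ^+ d * (f b).@[u].
  by apply: meval_homog => // i; rewrite v0 mul0r.
case: (posnP d) => [d0|dpos]; last first.
  move=> a c; rewrite !big1 ?mulr0 // => b _;
    by rewrite (scal0 b v) expr0n (gtn_eqF dpos) mul0r mulr0.
have const b u u' : (f b).@[u] = (f b).@[u'].
  by have := scal0 b u; rewrite (scal0 b u') d0 !mul1r.
pose v' := vec5 (1 : k) 0 0 0 0.
have Fv' : F.@[v'] = 0 by rewrite meval_cubic /v' /vec5 !inordK //= /cubic_form; ring.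
have v'0 : v' (inord 0) != 0 by rewrite /v' /vec5 inordK //= oner_neq0.
move=> a c; have := equivariant_at repr eqv hf pA GA Fv' v'0 (fun=> erefl) a c.
set w' := (fun _ => _); rewrite (const a w' w) (const c w' w).
by under eq_bigr => b _ do rewrite (const b v' v);
   under [X in _ = _ * X -> _]eq_bigr => b _ do rewrite (const b v' v).
Qed.

Lemma eigen_mix P f (R : 'M[k]_4) (eps : 'I_4 -> k) v w :
  (forall i j, (P *m R) i j = eps i * P i j) ->
  (forall a c, (f a).@[w] * (\sum_b R c b * (f b).@[v]) =
     (f c).@[w] * (\sum_b R a b * (f b).@[v])) ->
  forall a c, (mix P f a).@[w] * (eps c * (mix P f c).@[v]) =
     (mix P f c).@[w] * (eps a * (mix P f a).@[v]).
Proof.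
move=> PR par a c.
have epsE i : eps i * (mix P f i).@[v] = \sum_j P i j * (\sum_b R j b * (f b).@[v]).
  rewrite meval_mix mulr_sumr; under [RHS]eq_bigr => j _ do rewrite mulr_sumr.
  rewrite exchange_big /=; apply: eq_bigr => b _; rewrite mulrA -PR mxE mulr_suml.
  by apply: eq_bigr => j _; rewrite mulrA.
rewrite !epsE !meval_mix !mulr_suml; under eq_bigr => i _ do rewrite mulr_sumr.
under [RHS]eq_bigr => i _ do rewrite mulr_sumr.
rewrite exchange_big /=; apply: eq_bigr => j _; apply: eq_bigr => i _.
by rewrite mulrACA par; ring.
Qed.

(** After a change of coordinates that diagonalises the representation, the maps
    and their equivariance become the polynomial identities of
    [no_diagonal_klein_map]. *)
Theorem no_klein_linearisation (G : (points X -> points X) -> Prop) :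
  nonsing_quartic (h ^+ 2) (- d3) (- e1) (- e2) (- e3) ->
  G id -> G (tauX (-1)) -> G sigmaX -> ~ linearizable 3 G.
Proof.
move=> smooth Gid GT GS [rho [repr [f [[[[d hf] _ _] [g [[[e hg] _ _] [def cancel_fg] _]]] eqv]]]].
have n0 : -1 != 0 :> k by rewrite oppr_eq0 oner_neq0.
have pt := preserves_tau n0; have ps := preserves_sigma.
have [|||P [eps [del [uP eps0 del0 epsE delE]]]] :=
    klein_representation_diag (natrS_neq0 char0 1) repr Gid GT GS.
- by rewrite -(restr_mul pt pt).2 tau_mxM mulrNN mulr1 tau_mx1 preserves1.2.
- by rewrite -(restr_mul ps ps).2 sigma_mx2 preserves1.2.
- exact: flip_swap_comm.
have comp_eval v j : (comp_tuple f g j).@[v] = (g j).@[fun a => (f a).@[v]].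
  rewrite /comp_tuple -[LHS]/((meval v) _) [LHS](rmorph_mmap _ _ (meval v)).
  by apply: mmap_eq => [c|a] //=; rewrite mevalC.
have flipE v : (fun i => \sum_j tau_mx (-1) i j * v j) =1 flip v.
  by move=> i; rewrite tau_mxE /flip !mulN1r invrN invr1 mulN1r.
have cross v : F.@[v] = 0 -> forall l a c, (f l).@[v] *
    ((comp_tuple f g a).@[v] * v c - (comp_tuple f g c).@[v] * v a) = 0.
  move=> Fv l a c; rewrite !comp_eval.
  have [->|fl] := eqVneq (f l).@[v] 0; first by rewrite mul0r.
  have [[i vi]|no] := classic (exists i, v i != 0); last first.
    have v0 i : v i = 0 by apply/eqP/negPn/negP => ne; apply: no; exists i.
    by rewrite !v0 !mulr0 subrr mulr0.
  set y := fun a => _.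
  have [[j gj]|no] := classic (exists j, (g j).@[y] != 0); last first.
    have g0 j : (g j).@[y] = 0 by apply/eqP/negPn/negP => ne; apply: no; exists j.
    by rewrite !g0 !mul0r subrr mulr0.
  have [p pE] := point_at vi Fv.
  have [q qE] := proj_at (v := y) fl.
  have [r rE] := proj_at (v := fun j => (g j).@[y]) gj.
  have rp := cancel_fg _ q r (valP p) ((maps_to_at q hf pE).2 qE) ((maps_to_at r hg qE).2 rE).
  have par : line (fun j => (g j).@[y]) = line v by rewrite -rE rp pE.
  by rewrite (line_parallel par a c) subrr mulr0.
have nonempty : exists v l a, F.@[v] = 0 /\ (f l).@[v] * (comp_tuple f g a).@[v] != 0.
  have [p [q [r [Xp fpq gqr]]]] := def.
  have pE := proj_hcoord p; have qE := (maps_to_at q hf pE).1 fpq.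
  have rE := (maps_to_at r hg qE).1 gqr.
  have [l fl] := proj_at_neq0 qE; have [a ga] := proj_at_neq0 rE.
  exists (hcoord p), l, a; split; first exact/eqP.
  by rewrite comp_eval mulf_neq0.
pose f' := mix P f; pose g' := unmix P g.
apply: (@no_diagonal_klein_map k char0 h d3 e1 e2 e3 smooth d e f' g' eps del _ _ eps0 del0).
- by move=> a; apply: mix_homog.
- by move=> j; apply: unmix_homog.
- move=> v Fv l a c; rewrite !comp_unmix // meval_mix mulr_suml big1 // => b _.
  by rewrite -mulrA cross // mulr0.
- have [v [l [a [Fv ne]]]] := nonempty.
  have [[l' fl']|no] := classic (exists l', (f' l').@[v] != 0).
    exists v, l', a; split; first exact: Fv.
    rewrite comp_unmix //; apply: mulf_neq0; first exact: fl'.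
    by apply: contraNneq ne => ->; rewrite mulr0.
  have f'0 b : (f' b).@[v] = 0 by apply/eqP/negPn/negP => nb; apply: no; exists b.
  case/eqP: ne; suff -> : (f l).@[v] = 0 by rewrite mul0r.
  have := congr1 (fun M : 'cV[k]_4 => (invmx P *m M) l 0)
     (_ : P *m \col_b (f b).@[v] = 0).
  rewrite mulKmx // mulmx0 !mxE; apply; apply/colP => b; rewrite !mxE.
  transitivity ((f' b).@[v]); last exact: f'0.
  by rewrite meval_mix; apply: eq_bigr => c _; rewrite mxE.
- move=> v Fv a c; rewrite !meval_flip.
  exact: (eigen_mix epsE (equivariant_at0 repr eqv hf pt GT Fv (flipE v))).
move=> v Fv a c; rewrite !meval_swap.
exact: (eigen_mix delE (equivariant_at0 repr eqv hf ps GS Fv (sigma_mxE v))).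
Qed.

Lemma mderivXU (n : nat) (i j : 'I_n) : ('X_j)^`M(i) = (i == j)%:R :> {mpoly k[n]}.
Proof.
have subU (l : 'I_n) : (U_(l) - U_(l))%MM = 0%MM :> 'X_{1..n}.
  by apply/mnmP => l'; rewrite mnmBE subnn mnm0E.
rewrite mderivX mnm1E eq_sym; case: eqP => [->|_]; last by rewrite scale0r.
by rewrite subU mpolyX0 scale1r.
Qed.

(** If [x / y] is a multiple root [t] of [branch], this represents the point
    [0 : 0 : - h t^2 : t : 1]. *)
Definition vertex (x y c : k) : 'I_5 -> k :=
  vec5 0 0 (c * (- h * x ^+ 2)) (c * (x * y)) (c * y ^+ 2).

Lemma singular_vector (x y c : k) i :
  let v := vertex x y c in
  quartic_d1 (h ^+ 2) (- d3) (- e1) (- e2) x y = 0 ->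
  quartic_d2 (- d3) (- e1) (- e2) (- e3) x y = 0 ->
  (F^`M(i)).@[v] = 0 /\ F.@[v] = 0.
Proof.
move=> v dl dr; have Q0 : quartic (h ^+ 2) (- d3) (- e1) (- e2) (- e3) x y = 0.
  have four : 4 != 0 :> k := natrS_neq0 char0 3.
  apply: (mulfI four); rewrite mulr0.
  transitivity (x * quartic_d1 (h ^+ 2) (- d3) (- e1) (- e2) x y +
     y * quartic_d2 (- d3) (- e1) (- e2) (- e3) x y).
    by rewrite /quartic /quartic_d1 /quartic_d2; ring.
  by rewrite dl dr !mulr0 addr0.
split; last first.
  rewrite meval_cubic /v /vertex /vec5 !inordK //=.
  transitivity (- c ^+ 3 * y ^+ 2 * quartic (h ^+ 2) (- d3) (- e1) (- e2) (- e3) x y).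
    by rewrite /cubic_form /quartic; ring.
  by rewrite Q0 mulr0.
rewrite /cubic /cubic_form /coordx /= !expr2 !exprSr !expr0.
rewrite !(mderivD, mderivM, mderivC, mderivXU) .
have nat_eval (b : bool) : (b%:R : {mpoly k[5]}).@[v] = b%:R by case: b; rewrite ?meval0 ?meval1.
rewrite !(mevalD, mevalM, mevalC, mevalXU, meval0, meval1) !nat_eval.
rewrite /v /vertex /vec5 !inordK //=.
move: (i == _)%:R (i == inord 1)%:R (i == inord 2)%:R (i == inord 3)%:R (i == inord 4)%:R.
move=> a0 a1 a2 a3 a4.
transitivity (c ^+ 2 * (a4 * (quartic (h ^+ 2) (- d3) (- e1) (- e2) (- e3) x y
     - y * quartic_d2 (- d3) (- e1) (- e2) (- e3) x y)
   - a3 * (y * quartic_d1 (h ^+ 2) (- d3) (- e1) (- e2) x y))).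
  by rewrite /quartic /quartic_d1 /quartic_d2; ring.
by rewrite Q0 dl dr !mulr0 !subr0 !mulr0.
Qed.

Lemma fixed_of_generators (G0 : (points X -> points X) -> Prop) (p : points X) :
  (forall phi, G0 phi -> phi p = p) -> forall phi, generated G0 phi -> phi p = p.
Proof.
move=> fix0 phi; elim=> [psi /fix0|//|a b _ aE _ bE|a b _ aE ab _] //=.
  by rewrite bE.
by rewrite -{1}aE ab.
Qed.

(** A common zero of the derivatives yields a singular point with
    [x1 = x2 = 0], which both generators fix. *)
Lemma smooth_branch (zeta : k) : zeta != 0 -> (h != 0) || (d3 != 0) ->
  (forall p : points X, singular p -> ~ (forall g, dihedral zeta g -> g p = p)) ->
  nonsing_quartic (h ^+ 2) (- d3) (- e1) (- e2) (- e3).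
Proof.
move=> z0 hd nofix x y dl dr.
have [y0|y0] := eqVneq y 0.
  split=> //; apply/eqP/negPn/negP => x0.
  have four : 4 != 0 :> k := natrS_neq0 char0 3.
  have : 4 * h ^+ 2 * x ^+ 3 = 0 by rewrite -dl y0 /quartic_d1; ring.
  have : d3 * x ^+ 3 = 0 by rewrite -oppr0 -dr y0 /quartic_d2; ring.
  move/eqP; rewrite mulf_eq0 expf_eq0 (negbTE x0) orbF => /eqP d30 /eqP.
  rewrite mulf_eq0 (negbTE (expf_neq0 3 x0)) orbF mulf_eq0 (negbTE four) expf_eq0 /= => /eqP h0.
  by move: hd; rewrite h0 d30 eqxx.
exfalso; pose v := vertex x y 1.
have Fv : F.@[v] = 0 by have [] := singular_vector 1 ord0 dl dr.
have v4 : v (inord 4) != 0 by rewrite /v /vertex /vec5 inordK //= mul1r expf_neq0.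
have [p pE] := point_at v4 Fv; have [c c0 cE] := hcoord_at pE.
have fixp A w : preserves A -> (fun i => \sum_j A i j * v j) =1 w -> w =1 v ->
    restr A p = p.
  move=> pA Aw wv; apply: point_eq; rewrite (restr_at pA pE) pE.
  by apply: (line_scale (oner_neq0 k)) => i; rewrite mul1r Aw wv.
have fix0 := preserves_tau z0; have fix1 := preserves_sigma.
apply: (nofix p).
  move=> i; have [<- _] := singular_vector c i dl dr.
  apply: meval_eq => j; rewrite cE /v -[LHS]/(( *%R c \o vertex x y 1) j) comp_vec5.
  by rewrite /vertex mulr0 !mul1r.
apply: fixed_of_generators => phi [->|->].
  apply: fixp fix0 (tau_mxE zeta v) _ => i.
  by rewrite [RHS]vec5_eta /v /vertex /vec5 !inordK //= !mulr0.
apply: fixp fix1 (sigma_mxE v) _ => i.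
by rewrite /swap [RHS]vec5_eta /v /vertex /vec5 !inordK.
Qed.

Lemma tauX_pow zeta m : zeta != 0 -> dihedral zeta (tauX (zeta ^+ m)).
Proof.
move=> z0; elim: m => [|m IH]; first by rewrite expr0 tau_mx1 preserves1.2; exact: gen_id.
rewrite exprS -tau_mxM (restr_mul (preserves_tau z0) (preserves_tau (expf_neq0 m z0))).2.
by apply: gen_comp IH; apply: gen_base; left.
Qed.

Lemma Aut_restr A B : preserves A -> preserves B -> A *m B = 1%:M -> B *m A = 1%:M ->
  Aut (restr (Z := X) A).
Proof.
have reg C : preserves C -> regular (restr (Z := X) C).
  move=> pC p; exists (fun i => \sum_j C i j *: 'X_j), 0%N, 1.
  have hl i : (\sum_j C i j *: 'X_j : {mpoly k[5]}) \is 1.-homog.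
    by apply: rpred_sum => a _; apply: rpredZ; rewrite dhomogX /= mdeg1.
  split; [by exists 1%N|exact: dhomog1|by rewrite meval1 oner_neq0|move=> q _].
  apply/(maps_to_at _ hl (proj_hcoord _)); rewrite (restr_at pC (proj_hcoord _)).
  apply: (line_scale (oner_neq0 k)) => i; rewrite mul1r raddf_sum /=.
  by apply: eq_bigr => j _; rewrite mevalZ mevalXU.
move=> pA pB AB BA; split; first exact: reg.
exists (restr B); split; first exact: reg.
  move=> p; have := congr1 (fun phi : points X -> points X => phi p) (restr_mul pB pA).2.
  by rewrite BA preserves1.2.
move=> p; have := congr1 (fun phi : points X -> points X => phi p) (restr_mul pA pB).2.
by rewrite AB preserves1.2.
Qed.

Theorem not_linearizable_cubic (n : nat) (zeta : k) :
  (2 <= n)%N -> ~~ odd n -> n.-primitive_root zeta -> (h != 0) || (d3 != 0) ->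
  (forall p : points X, singular p -> ~ (forall g, dihedral zeta g -> g p = p)) ->
  ~ linearizable 3 (dihedral zeta (Z := X)) /\ ~ linearizable 3 (@Aut k 4 X).
Proof.
move=> n2 n_even hz hd nofix.
have n0 : (0 < n)%N by apply: ltn_trans n2.
have z0 : zeta != 0.
  apply/eqP => z0; have /eqP := prim_expr_order hz.
  by rewrite z0 expr0n gtn_eqF // eq_sym oner_eq0.
have smooth := smooth_branch z0 hd nofix.
have m0 : -1 != 0 :> k by rewrite oppr_eq0 oner_neq0.
(* the power n/2 of tau_zeta is diag(-1, -1, 1, 1, 1) *)
have zhalf : zeta ^+ n./2 = -1.
  have sq : (zeta ^+ n./2) ^+ 2 = 1.
    rewrite -exprM muln2 -[RHS](prim_expr_order hz); congr (_ ^+ _).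
    by rewrite -[RHS]odd_double_half (negbTE n_even).
  have /eqP := sq; rewrite sqrf_eq1 => /orP [/eqP z1|/eqP //].
  have hdvd : (n %| n./2)%N by rewrite (prim_order_dvd hz) z1 eqxx.
  have := dvdn_leq (_ : 0 < n./2)%N hdvd; rewrite half_gt0 => /(_ n2).
  by rewrite leqNgt ltn_half_double -addnn -[X in (X < _)%N]addn0 ltn_add2l n0.
have pt := preserves_tau m0; have ps := preserves_sigma.
split; apply: no_klein_linearisation => //.
- exact: gen_id.
- by rewrite -zhalf; exact: tauX_pow.
- by apply: gen_base; right.
- rewrite -preserves1.2; apply: (Aut_restr (B := 1%:M)); rewrite ?mulmx1 //; exact: preserves1.1.
- by apply: (Aut_restr pt pt); rewrite tau_mxM mulrNN mulr1 tau_mx1.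
- by apply: (Aut_restr ps ps); exact: sigma_mx2.
Qed.

End Translate.

Lemma cubic1E (k : closedFieldType) (e1 e2 e3 : k) : 2 != 0 :> k ->
  cubic1 e1 e2 e3 = cubic 2^-1 0 e1 e2 e3.
Proof.
move=> two; rewrite /cubic1 /cubic /cubic_form -!mul_mpolyC mpolyC0.
have -> : 2 * (2^-1)%:MP = 1 :> {mpoly k[5]}.
  by rewrite -(rmorph_nat (@mpolyC 5 k) 2) -rmorphM mulfV.
by ring.
Qed.

Lemma cubic2E (k : closedFieldType) (e1 e2 : k) : cubic2 e1 e2 = cubic 0 1 0 e1 e2.
Proof. by rewrite /cubic2 /cubic /cubic_form -!mul_mpolyC mpolyC0 mpolyC1; ring. Qed.

Theorem theorem4p3 (k : closedFieldType) (hk : [pchar k] =i pred0)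
    (F : {mpoly k[5]})
    (hF : (exists e1 e2 e3 : k, F = cubic1 e1 e2 e3)
          \/ (exists e1 e2 : k, F = cubic2 e1 e2))
    (n : nat) (hn : (2 <= n)%N) (hn_even : ~~ odd n)
    (zeta : k) (hzeta : n.-primitive_root zeta) :
  let X := hypersurface F in
  let G : (points X -> points X) -> Prop := dihedral zeta in
  (forall p : points X, singular p -> ~ (forall g, G g -> g p = p)) ->
  ~ linearizable 3 G /\ ~ linearizable 3 (@Aut k 4 X).
Proof.
have two : 2 != 0 :> k := natrS_neq0 hk 1.
case: hF => [[e1 [e2 [e3 ->]]]|[e1 [e2 ->]]].
  rewrite cubic1E //; apply: (not_linearizable_cubic hk hn hn_even hzeta).
  by rewrite invr_eq0 two.
rewrite cubic2E; apply: (not_linearizable_cubic hk hn hn_even hzeta).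
by rewrite oner_neq0 orbT.
Qed.
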